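(* Let $\kappa$ be an algebraically closed field. The schemic Grothendieck ring in dimension zero, $\mathbf{Gr}_0(\mathrm{Sch}_\kappa)$, is freely generated, as an additive group, by the isomorphism classes of fat points over $\kappa$.
   Context: A $\kappa$-scheme is a separated scheme of finite type over $\kappa$. A fat point is a $\kappa$-scheme $\mathfrak z$, finite over $\kappa$, with a unique point; $\mathrm{Fat}_\kappa$ is the category of fat points and $\kappa$-morphisms. For a $\kappa$-scheme $X$ put $X(\mathfrak z)=\operatorname{Mor}_\kappa(\mathfrak z,X)$ and let $X^\circ$ be the contravariant functor $\mathfrak z\mapsto X(\mathfrak z)$ from $\mathrm{Fat}_\kappa$ to sets. A sieve on $X$ is a subfunctor of $X^\circ$; morphisms of sieves are natural transformations; unions, intersections and products are pointwise. A schemic motif on $X$ is a finite union of sieves $X_i^\circ$ with $X_i\subseteq X$ closed subschemes. $\mathbf{Gr}_0(\mathrm{Sch}_\kappa)$ is the free abelian group on symbols $\langle\mathfrak X\rangle$, where $\mathfrak X$ runs over all schemic motives on zero-dimensional $\kappa$-schemes, modulo the scissor relations $\langle\mathfrak X\rangle+\langle\mathfrak Y\rangle-\langle\mathfrak X\cup\mathfrak Y\rangle-\langle\mathfrak X\cap\mathfrak Y\rangle$ for $\mathfrak X,\mathfrak Y$ on a common zero-dimensional scheme, and the isomorphism relations $\langle\mathfrak X\rangle-\langle\mathfrak Y\rangle$ for isomorphic $\mathfrak X,\mathfrak Y$; multiplication is induced by products. The class of the empty motif is $0$ by convention. The class of a fat point $\mathfrak z$ is the class of $\mathfrak z^\circ$.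 *)

(* Defs.v *)
From HB Require Import structures.
From mathcomp Require Import all_boot all_order all_algebra.
From mathcomp Require Import all_classical topology.

Set Implicit Arguments.
Unset Strict Implicit.
Unset Printing Implicit Defensive.

Import GRing.Theory.
Local Open Scope classical_set_scope.
Local Open Scope ring_scope.

(** * Locally ringed spaces *)

Record opens (X : topologicalType) := Opens {
  oset :> set X;
  oset_open : open oset
}.
Arguments Opens {X} oset oset_open.

Definition otop (X : topologicalType) : opens X := Opens setT openT.

Lemma otop_sub (X : topologicalType) (U : opens X) : U `<=` otop X.
Proof. by []. Qed.

Definition opreim (X Y : topologicalType) (f : X -> Y) (cf : continuous f)
    (V : opens Y) : opens X :=
  Opens (f @^-1` V) (proj1 (continuousP f) cf _ (oset_open V)).

(* Rings of sections may be trivial: [sec] of the empty open set is zero. *)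
Record ringedSpace := RingedSpace {
  rs_top :> topologicalType;
  sec : opens rs_top -> comPzRingType;
  res : forall U V : opens rs_top, V `<=` U -> {rmorphism sec U -> sec V};
  res_id : forall (U : opens rs_top) (h : U `<=` U) (s : sec U), res h s = s;
  res_res : forall (U V W : opens rs_top) (hV : V `<=` U) (hW : W `<=` V)
    (h : W `<=` U) (s : sec U), res hW (res hV s) = res h s;
  sec_separated : forall (U : opens rs_top) (I : Type) (C : I -> opens rs_top)
    (hC : forall i, C i `<=` U), U `<=` \bigcup_i C i ->
    forall s t : sec U,
      (forall i, res (hC i) s = res (hC i) t) -> s = t;
  sec_glue : forall (U : opens rs_top) (I : Type) (C : I -> opens rs_top)
    (hC : forall i, C i `<=` U), U `<=` \bigcup_i C i ->
    forall s : (forall i, sec (C i)),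
      (forall i j (W : opens rs_top) (hi : W `<=` C i) (hj : W `<=` C j),
          res hi (s i) = res hj (s j)) ->
      exists t : sec U, forall i, res (hC i) t = s i
}.
Arguments sec {r} U.
Arguments res {r U V} h.

(* The germ of [s] at [x] is a unit of the stalk at [x] (in particular [x]
   lies in [U]). *)
Definition unit_at (X : ringedSpace) (U : opens X) (s : sec U) : set X :=
  [set x | exists (V : opens X) (h : V `<=` U),
     oset V x /\ exists t : sec V, res h s * t = 1].

Lemma unit_at_open (X : ringedSpace) (U : opens X) (s : sec U) :
  open (unit_at s).
Proof.
rewrite openE => x [V [h [Vx [t st]]]].
rewrite /interior nbhsE; exists (oset V); first by split => //; exact: oset_open.
by move=> y Vy; exists V, h; split => //; exists t.
Qed.

Definition basic_open (X : ringedSpace) (U : opens X) (s : sec U) : opens X :=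
  Opens (unit_at s) (unit_at_open s).

Lemma basic_open_sub (X : ringedSpace) (U : opens X) (s : sec U) :
  basic_open s `<=` U.
Proof. by move=> x [V [h [Vx _]]]; exact: h. Qed.

(* Every stalk is a local ring: it is nonzero and, for each germ [s], one of
   [s] and [1 - s] is a unit. *)
Definition locally_ringed (X : ringedSpace) : Prop :=
  forall (x : X) (U : opens X), oset U x ->
    (1 : sec U) != 0 /\
    forall s : sec U, unit_at s x \/ unit_at (1 - s) x.

(** * Schemes *)

Definition prime_ideal (A : comPzRingType) (P : set A) : Prop :=
  [/\ P 0, forall a b, P a -> P b -> P (a + b),
      forall a b, P b -> P (a * b),
      ~ P 1 & forall a b, P (a * b) -> P a \/ P b].

(* [(U, O|U)] is affine: the canonical morphism from [U] to the spectrum of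
   [sec U], which sends [x] to the prime ideal of the [s] whose germ at [x] is
   not a unit, is an isomorphism.  Spelled out: it is injective, surjective
   and a homeomorphism (the preimages [basic_open s] of the principal open sets
   form a basis of [U]), and [sec (basic_open s)] is the localization of
   [sec U] at [s]. *)
Definition affine_open (X : ringedSpace) (U : opens X) : Prop :=
  [/\ forall x y, oset U x -> oset U y ->
        (forall s : sec U, unit_at s x <-> unit_at s y) -> x = y,
      forall P : set (sec U), prime_ideal P ->
        exists2 x, oset U x & forall s, P s <-> ~ unit_at s x,
      forall (V : opens X) x, V `<=` U -> oset V x ->
        exists s : sec U, unit_at s x /\ unit_at s `<=` V,
      forall s a : sec U, res (basic_open_sub (s := s)) a = 0 ->
        exists n : nat, s ^+ n * a = 0
    & forall (s : sec U) (b : sec (basic_open s)),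
        exists (n : nat) (a : sec U),
          res (basic_open_sub (s := s)) a =
          res (basic_open_sub (s := s)) s ^+ n * b].

Section OverField.
Variable K : fieldType.

(* A scheme with a morphism to [Spec K], i.e. a ring morphism from [K] to the
   global sections. *)
Record overScheme := OverScheme {
  os_rs :> ringedSpace;
  os_local : locally_ringed os_rs;
  os_scheme : forall x : os_rs, exists2 U : opens os_rs, oset U x & affine_open U;
  os_str : {rmorphism K -> sec (otop os_rs)}
}.

Definition scal (X : overScheme) (U : opens X) (a : K) : sec U :=
  res (@otop_sub X U) (os_str X a).
Arguments scal {X} U a.

Lemma res_scal (X : overScheme) (U V : opens X) (h : V `<=` U) (a : K) :
  res h (scal U a) = scal V a.
Proof. exact: res_res. Qed.

(* [mor_sec] is the map of sheaves on [Y], and [mor_local] says that the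
   induced maps on stalks are local. *)
Record mor (X Y : overScheme) := Mor {
  mor_fun :> X -> Y;
  mor_cont : continuous mor_fun;
  mor_sec : forall V : opens Y, {rmorphism sec V -> sec (opreim mor_cont V)};
  mor_res : forall (V W : opens Y) (h : W `<=` V)
    (h' : opreim mor_cont W `<=` opreim mor_cont V) (s : sec V),
    mor_sec W (res h s) = res h' (mor_sec V s);
  mor_local : forall (V : opens Y) (s : sec V) (x : X), oset V (mor_fun x) ->
    unit_at (mor_sec V s) x -> unit_at s (mor_fun x);
  mor_scal : forall (V : opens Y) (a : K), mor_sec V (scal V a) = scal _ a
}.

Lemma rmorphism_ext (A B : comPzRingType) (f g : {rmorphism A -> B}) :
  f =1 g -> f = g.
Proof.
case: f g => [f [[f1] [f2]]] [g [[g1] [g2]]] /= /funext fg.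
subst g; congr (GRing.RMorphism.Pack _).
by rewrite (Prop_irrelevance f1 g1) (Prop_irrelevance f2 g2).
Qed.

Lemma mor_ext (X Y : overScheme) (f g : mor X Y) :
  (forall x, f x = g x) ->
  (forall (V : opens Y) (s : sec V) (W : opens X)
     (hf : W `<=` opreim (@mor_cont _ _ f) V)
     (hg : W `<=` opreim (@mor_cont _ _ g) V),
     res hf (mor_sec f V s) = res hg (mor_sec g V s)) ->
  f = g.
Proof.
case: f g => [f cf fs f1 f2 f3] [g cg gs g1 g2 g3] /= /funext fg.
subst g.
have ecg := Prop_irrelevance cf cg; subst cg => H.
have E : fs = gs.
  apply: functional_extensionality_dep => V; apply: rmorphism_ext => s.
  by have := H V s (opreim cf V) (@subset_refl _ _) (@subset_refl _ _); rewrite !res_id.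
subst gs; congr Mor; exact: Prop_irrelevance.
Qed.

Lemma id_continuous (X : topologicalType) : continuous (@idfun X).
Proof. by move=> x; exact: cvg_id. Qed.

Lemma id_opreim_sub (X : topologicalType) (V : opens X) :
  opreim (@id_continuous X) V `<=` V.
Proof. by []. Qed.

Definition mor_id (X : overScheme) : mor X X.
Proof.
refine (@Mor X X idfun (@id_continuous X)
  (fun V => res (@id_opreim_sub X V)) _ _ _).
- by move=> V W h h' s; rewrite !(res_res _ _ (subset_trans (@id_opreim_sub _ W) h)).
- move=> V s x Vx [W [h [Wx [t st]]]].
  exists W, (subset_trans h (@id_opreim_sub X V)); split=> //; exists t.
  by rewrite -st (res_res _ _ (subset_trans h (@id_opreim_sub X V))).
- by move=> V a; exact: res_scal.
Defined.

Lemma comp_cont (X Y Z : topologicalType) (g : Y -> Z) (f : X -> Y) :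
  continuous g -> continuous f -> continuous (g \o f).
Proof. by move=> cg cf x; apply: continuous_comp; [exact: cf|exact: cg]. Qed.

Lemma comp_opreim_sub (X Y Z : topologicalType) (g : Y -> Z) (f : X -> Y)
    (cg : continuous g) (cf : continuous f) (V : opens Z) :
  opreim (comp_cont cg cf) V `<=` opreim cf (opreim cg V).
Proof. by []. Qed.

Definition mor_comp (X Y Z : overScheme) (g : mor Y Z) (f : mor X Y) : mor X Z.
Proof.
pose cg := @mor_cont _ _ g; pose cf := @mor_cont _ _ f.
refine (@Mor X Z (g \o f) (comp_cont cg cf)
  (fun V => res (@comp_opreim_sub _ _ _ _ _ cg cf V) \o
            (mor_sec f (opreim cg V) \o mor_sec g V)) _ _ _).
- move=> V W h h' s /=.
  have hg : opreim cg W `<=` opreim cg V by move=> y; exact: h.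
  have hf : opreim cf (opreim cg W) `<=` opreim cf (opreim cg V) by move=> y; exact: h.
  rewrite (mor_res h hg) (mor_res hg hf).
  by rewrite !(res_res _ _ (subset_trans (@comp_opreim_sub _ _ _ _ _ cg cf W) hf)).
- move=> V s x Vx [W [h [Wx [t /= st]]]].
  apply: (@mor_local _ _ g) => //; apply: (@mor_local _ _ f) => //.
  exists W, (subset_trans h (@comp_opreim_sub _ _ _ _ _ cg cf V)); split=> //.
  by exists t; rewrite -st; congr (_ * _); rewrite (res_res _ _ (subset_trans h (@comp_opreim_sub _ _ _ _ _ cg cf V))).
- move=> V a /=; rewrite !mor_scal; exact: res_scal.
Defined.

Lemma mor_comp_idl (X Y : overScheme) (f : mor X Y) :
  mor_comp (mor_id Y) f = f.
Proof.
apply: mor_ext => // V s W hf hg.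
pose cf := @mor_cont _ _ f.
have h' : opreim cf (opreim (@id_continuous Y) V) `<=` opreim cf V by [].
have hW : W `<=` opreim cf (opreim (@id_continuous Y) V) by [].
rewrite -(res_res h' hW hg) -(mor_res (@id_opreim_sub Y V)).
exact: res_res.
Qed.

(* Injective, continuous and closed, i.e. a homeomorphism onto a closed subset,
   and surjective on stalks. *)
Definition closed_immersion (Y X : overScheme) (i : mor Y X) : Prop :=
  [/\ injective i, forall F : set Y, closed F -> closed (i @` F)
    & forall (y : Y) (U : opens Y) (t : sec U), oset U y ->
        exists (V : opens X) (s : sec V) (W : opens Y)
          (hU : W `<=` U) (hV : W `<=` opreim (@mor_cont _ _ i) V),
          oset W y /\ res hV (mor_sec i V s) = res hU t].

Definition is_product (P X Y : overScheme) (p : mor P X) (q : mor P Y) : Prop :=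
  forall (T : overScheme) (f : mor T X) (g : mor T Y),
    exists! h : mor T P, mor_comp p h = f /\ mor_comp q h = g.

(* The diagonal of [X] over [K] is a closed immersion; the fibre product is
   only determined up to isomorphism, hence the quantification. *)
Definition separated (X : overScheme) : Prop :=
  forall (P : overScheme) (p q : mor P X), is_product p q ->
  forall d : mor X P, mor_comp p d = mor_id X -> mor_comp q d = mor_id X ->
    closed_immersion d.

Definition fg_algebra (X : overScheme) (U : opens X) : Prop :=
  exists gens : seq (sec U), forall S : set (sec U),
    (forall a, S (scal U a)) -> (forall g, g \in gens -> S g) ->
    (forall a b, S a -> S b -> S (a + b)) ->
    (forall a b, S a -> S b -> S (a * b)) ->
    forall a, S a.

Definition finite_type (X : overScheme) : Prop :=
  exists (n : nat) (C : 'I_n -> opens X),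
    (forall i, affine_open (C i) /\ fg_algebra (C i)) /\
    forall x, exists i, oset (C i) x.

(* Finite over [Spec K]: affine, with global sections a finite [K]-module. *)
Definition finite_over (X : overScheme) : Prop :=
  affine_open (otop X) /\
  exists (n : nat) (g : 'I_n -> sec (otop X)), forall a,
    exists c : 'I_n -> K, a = \sum_(i < n) os_str X (c i) * g i.

Record kscheme := KScheme {
  ks_over :> overScheme;
  ks_separated : separated ks_over;
  ks_finite_type : finite_type ks_over
}.

Definition irreducible_set (X : topologicalType) (Z : set X) : Prop :=
  Z !=set0 /\ forall A B, closed A -> closed B -> Z `<=` A `|` B ->
    Z `<=` A \/ Z `<=` B.

(* Krull dimension at most zero; the empty scheme is included. *)
Definition zero_dim (X : topologicalType) : Prop :=
  forall Z Z' : set X, closed Z -> irreducible_set Z -> closed Z' ->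
    irreducible_set Z' -> Z `<=` Z' -> Z = Z'.

Record fatPoint := FatPoint {
  fp_ks :> kscheme;
  fp_finite : finite_over fp_ks;
  fp_point : exists x : fp_ks, forall y, y = x
}.

Definition fat_iso (z w : fatPoint) : Prop :=
  exists (f : mor z w) (g : mor w z),
    mor_comp g f = mor_id z /\ mor_comp f g = mor_id w.

(** * Sieves and schemic motives *)

Record sieve (X : kscheme) := Sieve {
  sv :> forall z : fatPoint, mor z X -> Prop;
  sv_comp : forall (z w : fatPoint) (g : mor w z) (f : mor z X),
    sv f -> sv (mor_comp f g)
}.

Definition full_sieve (X : kscheme) : sieve X :=
  @Sieve X (fun _ _ => True) (fun _ _ _ _ _ => I).

Definition sieve_union (X : kscheme) (S T : sieve X) : sieve X.
Proof.
refine (@Sieve X (fun z f => S z f \/ T z f) _).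
by move=> z w g f [/sv_comp|/sv_comp] H; [left|right]; exact: H.
Defined.

Definition sieve_inter (X : kscheme) (S T : sieve X) : sieve X.
Proof.
refine (@Sieve X (fun z f => S z f /\ T z f) _).
by move=> z w g f [/sv_comp Sf /sv_comp Tf]; split; [exact: Sf|exact: Tf].
Defined.

Definition elt (X : kscheme) (S : sieve X) (z : fatPoint) : Type :=
  {f : mor z X | S z f}.

Definition elt_pull (X : kscheme) (S : sieve X) (z w : fatPoint) (g : mor w z)
    (a : elt S z) : elt S w :=
  exist _ (mor_comp (sval a) g) (sv_comp g (svalP a)).

Record sieve_mor (X Y : kscheme) (S : sieve X) (T : sieve Y) := SieveMor {
  sm_fun :> forall z : fatPoint, elt S z -> elt T z;
  sm_natural : forall (z w : fatPoint) (g : mor w z) (a : elt S z),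
    sm_fun (elt_pull g a) = elt_pull g (sm_fun a)
}.

Definition sieve_iso (X Y : kscheme) (S : sieve X) (T : sieve Y) : Prop :=
  exists (f : sieve_mor S T) (g : sieve_mor T S),
    forall z, cancel (f z) (g z) /\ cancel (g z) (f z).

Definition schemic (X : kscheme) (S : sieve X) : Prop :=
  exists (n : nat) (Y : 'I_n -> kscheme) (i : forall k, mor (Y k) X),
    (forall k, closed_immersion (i k)) /\
    forall (z : fatPoint) (f : mor z X),
      S z f <-> exists (k : 'I_n) (g : mor z (Y k)), f = mor_comp (i k) g.

Record motif0 := Motif0 {
  mo_ks : kscheme;
  mo_dim : zero_dim mo_ks;
  mo_sieve : sieve mo_ks;
  mo_schemic : schemic mo_sieve
}.

End OverField.

(** * Abelian groups by generators and relations *)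

(* Universe levels forbid a choiceType structure on the type of all motives
   (it is larger than the carriers of the library's rings), so the abelian group
   generated by [T] is given by formal sums and its equality as a congruence,
   with [++] as addition.  [present_eq R] is equality in the abelian group with
   generators [T] and relators [R]. *)
Definition formal_sum (T : Type) := seq (int * T).

Inductive present_eq (T : Type) (R : formal_sum T -> Prop) :
    formal_sum T -> formal_sum T -> Prop :=
| PresentRefl c : present_eq R c c
| PresentSym c d : present_eq R c d -> present_eq R d c
| PresentTrans c d e : present_eq R c d -> present_eq R d e -> present_eq R c e
| PresentAdd c c' d d' : present_eq R c c' -> present_eq R d d' ->
    present_eq R (c ++ d) (c' ++ d')
| PresentComm c d : present_eq R (c ++ d) (d ++ c)
| PresentZero x : present_eq R [:: (0, x)] [::]
| PresentMerge m n x : present_eq R [:: (m, x); (n, x)] [:: (m + n, x)]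
| PresentRel r : R r -> present_eq R r [::].

(** * The schemic Grothendieck group in dimension zero *)

Section Grothendieck.
Variable K : fieldType.

Inductive gr0_relator : formal_sum (motif0 K) -> Prop :=
| Gr0Scissor (X : kscheme K) (dX : zero_dim X) (S T : sieve X)
    (hS : schemic S) (hT : schemic T)
    (hU : schemic (sieve_union S T)) (hI : schemic (sieve_inter S T)) :
    gr0_relator [:: (1, Motif0 dX hS); (1, Motif0 dX hT);
                    (-1, Motif0 dX hU); (-1, Motif0 dX hI)]
| Gr0Iso (A B : motif0 K) : sieve_iso (mo_sieve A) (mo_sieve B) ->
    gr0_relator [:: (1, A); (-1, B)]
| Gr0Empty (A : motif0 K) : (forall z f, ~ mo_sieve A z f) ->
    gr0_relator [:: (1, A)].

(* Equality in [Gr_0(Sch_K)]. *)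
Definition gr0_eq : formal_sum (motif0 K) -> formal_sum (motif0 K) -> Prop :=
  present_eq gr0_relator.

Lemma fat_zero_dim (z : fatPoint K) : zero_dim z.
Proof.
case: (fp_point z) => x Hx Z Z' _ [[y Zy] _] _ _ ZZ'.
apply/seteqP; split=> // t _.
by rewrite (Hx t) -(Hx y).
Qed.

Lemma id_closed_immersion (X : overScheme K) : closed_immersion (mor_id X).
Proof.
split; first by [].
- by move=> F cF; rewrite image_id.
- move=> y U t Uy; exists U, t, U, (@subset_refl _ _), (@subset_refl _ _).
  by split=> //=; rewrite !(res_res _ _ (@subset_refl _ (oset U))).
Qed.

Lemma full_schemic (X : kscheme K) : schemic (full_sieve X).
Proof.
exists 1%N, (fun=> X), (fun=> mor_id X); split; first by move=> _; exact: id_closed_immersion.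
move=> z f; split=> // _; exists ord0, f; by rewrite mor_comp_idl.
Qed.

Definition fat_motif (z : fatPoint K) : motif0 K :=
  @Motif0 K z (@fat_zero_dim z) (full_sieve z) (full_schemic z).

Definition fat_sum (n : nat) (a : 'I_n -> int) (z : 'I_n -> fatPoint K) :
    formal_sum (motif0 K) :=
  [seq (a i, fat_motif (z i)) | i <- enum 'I_n].

End Grothendieck.

(* Main.v *)
Require Import Defs.
From HB Require Import structures.
From mathcomp Require Import all_boot all_order all_algebra.
From mathcomp Require Import all_classical topology.

(** Spanning.  Let [X] be zero-dimensional of finite type over the algebraically
    closed field [K].  The coordinate ring of an affine open set is generated by
    elements algebraic over [K]: otherwise some prime avoids all [p(a)], and the
    residue field there contradicts Zariski's lemma, which follows from the fact
    that a polynomial ring [B[t]] over a domain never becomes a field by inverting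
    one element.  Hence [X] is finite and discrete, with local rings finite over
    [K].  The morphisms from fat points that hit a given point and kill a given
    family of sections form a sieve that is empty or represented by the spectrum
    of a quotient of the local ring; such sieves are stable under intersection
    and every schemic motif is a finite union of them, so inclusion-exclusion
    writes its class as a combination of fat points.

    Independence.  The same induction writes the indicator function of a motif
    [S] as an integer combination of indicators of subfunctors generated by
    monic elements [a_k : w_k -> S].  Evaluating at a maximal [a_k] shows that,
    for each fat point [u], the sum of the coefficients with [w_k] isomorphic to
    [u] depends only on [S].  It is invariant under isomorphism and additive for
    the scissor relations, and it separates the classes of fat points. *)

Set Implicit Arguments.
Unset Strict Implicit.
Unset Printing Implicit Defensive.

Import GRing.Theory.
Local Open Scope classical_set_scope.
Local Open Scope quotient_scope.
Local Open Scope ring_scope.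

(** * Prime ideals and quotients *)

Definition is_ideal (A : comPzRingType) (J : set A) : Prop :=
  [/\ J 0, forall a b, J a -> J b -> J (a + b) & forall a b, J b -> J (a * b)].

Lemma idealB (A : comPzRingType) (J : set A) a b :
  is_ideal J -> J a -> J b -> J (a - b).
Proof.
by move=> [_ JD JM] Ja Jb; apply: JD => //; rewrite -mulN1r; apply: JM.
Qed.

Lemma prime_is_ideal (A : comPzRingType) (P : set A) : prime_ideal P -> is_ideal P.
Proof. by case. Qed.

Lemma prime_ideal_expr (A : comPzRingType) (P : set A) a n :
  prime_ideal P -> P (a ^+ n) -> P a.
Proof.
move=> [_ _ _ P1 PM]; elim: n => [|n IH]; first by rewrite expr0.
by rewrite exprS => /PM[|/IH].
Qed.

Lemma ideal_quotient (A : comPzRingType) (J : set A) : is_ideal J -> ~ J 1 ->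
  exists (Q : comPzRingType) (pi : {rmorphism A -> Q}),
    (forall q, exists a, pi a = q) /\ forall a, pi a = 0 <-> J a.
Proof.
move=> [J0 JD JM] J1.
have nz1 : (1 : A) != 0 by apply/eqP => E; apply: J1; rewrite E.
pose nzA := GRing.PzSemiRing_isNonZero.Build A nz1.
pose A' : comNzRingType := HB.pack A nzA.
pose I0 : pred A' := fun x => `[< J x >].
have I0c : idealr_closed I0.
  split=> [||a x y]; first exact/asboolP.
    by apply/negP => /asboolP.
  by move=> /asboolP Jx /asboolP Jy; apply/asboolP/JD => //; apply: JM.
pose I : idealr A' := HB.pack I0 (isIdealr.Build A' I0 I0c).
pose pi : {rmorphism A' -> {ideal_quot I}} := \pi_{ideal_quot I}.
have pi_surj (q : {ideal_quot I}) : exists a, pi a = q.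
  by exists (repr q); rewrite /pi /= reprK.
have pi_ker a : pi a = 0 <-> J a.
  have -> : (pi a = 0) <-> (a - 0 \in I).
    rewrite Quotient.idealrBE.
    have pi0 : pi 0 = 0 by rewrite rmorph0.
    by rewrite -pi0; split=> [E|/eqP E]; first exact/eqP.
  by rewrite subr0; split=> [/asboolP|?] //; apply/asboolP.
by exists {ideal_quot I}, pi.
Qed.

(** An ideal containing [I] and maximal among those disjoint from the multiplicative set [S] is
    prime; Zorn's lemma provides one. *)
Lemma prime_avoiding (A : comPzRingType) (S I : set A) :
  S 1 -> (forall a b, S a -> S b -> S (a * b)) -> is_ideal I ->
  (forall a, S a -> ~ I a) ->
  exists P, [/\ prime_ideal P, I `<=` P & forall a, S a -> ~ P a].
Proof.
move=> S1 SM [I0 ID IM] SI.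
(* Zorn runs over sets [X] with [X] united with [I] an ideal, so that the union of the empty chain
   is good as well. *)
pose good (X : set A) := is_ideal (X `|` I) /\ forall a, S a -> ~ (X `|` I) a.
have [F FP Ftot|X [[XI XS] Xmax]] := @Zorn_bigcup A good.
  split.
    split=> [|a b|a b]; first by right.
    - move=> [[Y FY Ya]|Ia] [[Z FZ Zb]|Ib].
      + have [YZ|ZY] := Ftot _ _ FY FZ.
          have [[_ D _] _] := FP _ FZ.
          have [] := D a b; [by left; apply: YZ|by left|by left; exists Z|by right].
        have [[_ D _] _] := FP _ FY.
        have [] := D a b; [by left|by left; apply: ZY|by left; exists Y|by right].
      + have [[_ D _] _] := FP _ FY.
        have [] := D a b; [by left|by right|by left; exists Y|by right].
      + have [[_ D _] _] := FP _ FZ.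
        have [] := D a b; [by right|by left|by left; exists Z|by right].
      + by right; apply: ID.
    - move=> [[Y FY Yb]|Ib]; last by right; apply: IM.
      have [[_ _ M] _] := FP _ FY.
      by have [] := M a b; [by left|by left; exists Y|by right].
  move=> a Sa [[Y FY Ya]|]; last exact: SI.
  by have [_ /(_ _ Sa)] := FP _ FY; apply; left.
set P := X `|` I in XI XS.
have [P0 PD PM] := XI.
(* By maximality, adjoining to [P] an element outside it produces an ideal that meets [S]. *)
have maxP a : ~ P a -> exists2 s, S s & exists p r, P p /\ s = p + r * a.
  move=> Pa; apply: contrapT => H.
  pose Y := [set y | exists p r, P p /\ y = p + r * a].
  have PY : P `<=` Y by move=> p Pp; exists p, 0; rewrite mul0r addr0.
  have YI : Y `|` I = Y.
    by apply/seteqP; split=> [y []// Iy|y]; [apply: PY; right|left].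
  have Ya : Y a by exists 0, 1; rewrite mul1r add0r.
  apply: (Xmax Y).
    split; first by move=> y Xy; apply: PY; left.
    by move=> /(_ _ Ya) Xa; apply: Pa; left.
  rewrite /good YI; split.
    split; first exact: PY.
    - move=> _ _ [p [r [Pp ->]]] [q [t [Pq ->]]]; exists (p + q), (r + t).
      by split; [exact: PD|rewrite mulrDl addrACA].
    - move=> c _ [p [r [Pp ->]]]; exists (c * p), (c * r).
      by split; [exact: PM|rewrite mulrDr mulrA].
  by move=> s Ss Ys; apply: H; exists s.
exists P; split; last 2 first.
- by move=> y; right.
- exact: XS.
split=> //; first exact: XS.
move=> a b Pab; apply: contrapT => /not_orP[Pa Pb].
(* The product [(p + r * a) * (q + u * b)] is in [S], yet [a * b] in [P] puts every term of its
   expansion in [P]. *)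
have [s Ss [p [r [Pp es]]]] := maxP _ Pa.
have [t St [q [u [Pq et]]]] := maxP _ Pb.
apply: (XS (s * t)); first exact: SM.
rewrite es et mulrDl mulrDr; apply: (PD).
  by rewrite -mulrDr mulrC; apply: (PM).
rewrite mulrDr; apply: (PD); first exact: PM.
by rewrite mulrACA; apply: PM.
Qed.

Lemma comPzRing_field (A : comPzRingType) : (1 : A) != 0 ->
  (forall x : A, x != 0 -> exists y, y * x = 1) ->
  exists (F : fieldType) (j : {rmorphism A -> F}), bijective j.
Proof.
move=> nz1 inv.
pose nzA := GRing.PzSemiRing_isNonZero.Build A nz1.
pose A' : comNzRingType := HB.pack A nzA.
(* Inverses are chosen classically; the default [0] serves the element [0], whose inverse must be
   [0] in a field structure. *)
pose i (x : A') : A' := if pselect (exists y, y * x = 1) is left h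
  then projT1 (cid h) else 0.
have iV (x : A') : x != 0 -> i x * x = 1.
  by move=> /inv h; rewrite /i; case: pselect => // h'; case: cid.
have i0 : i 0 = 0.
  rewrite /i; case: pselect => // h; case: cid => y /= /eqP.
  by rewrite mulr0 eq_sym (negPf nz1).
pose F : fieldType := HB.pack A' (GRing.ComNzRing_isField.Build A' iV i0).
by exists F, (idfun : {rmorphism F -> F}); exists id.
Qed.

(** * Zariski's lemma *)

Section SubringType.
Variables (F : fieldType) (S : subringClosed F).

Record subring_of := SubringOf {subring_val : F; _ : subring_val \in S}.

HB.instance Definition _ := [isSub for subring_val].
HB.instance Definition _ := [Choice of subring_of by <:].
HB.instance Definition _ := [SubChoice_isSubComNzRing of subring_of by <:].

End SubringType.

Section Goldman.
Variable F : fieldType.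

Definition is_subring (B : set F) : Prop :=
  [/\ B 1, forall x y, B x -> B y -> B (x - y) & forall x y, B x -> B y -> B (x * y)].

Section SubringTheory.
Variables (B : set F) (hB : is_subring B).

Lemma subring1 : B 1. Proof. by case: hB. Qed.
Lemma subringB x y : B x -> B y -> B (x - y). Proof. by case: hB => _ + _; apply. Qed.
Lemma subringM x y : B x -> B y -> B (x * y). Proof. by case: hB => _ _; apply. Qed.
Lemma subring0 : B 0. Proof. by rewrite -(subrr 1); apply: subringB; exact: subring1. Qed.
Lemma subringN x : B x -> B (- x).
Proof. by rewrite -sub0r; apply: subringB; exact: subring0. Qed.
Lemma subringD x y : B x -> B y -> B (x + y).
Proof. by move=> Bx By; rewrite -[y]opprK; apply: subringB => //; apply: subringN. Qed.
Lemma subringX x n : B x -> B (x ^+ n).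
Proof.
by move=> Bx; elim: n => [|n IH]; [exact: subring1|rewrite exprS; apply: subringM].
Qed.
Lemma subring_sum I (r : seq I) (P : pred I) (E : I -> F) :
  (forall i, P i -> B (E i)) -> B (\sum_(i <- r | P i) E i).
Proof. by move=> BE; apply: big_ind => //; [exact: subring0|exact: subringD]. Qed.

(** Integrality is taken along a ring morphism into [F]; this exhibits the set [B] as the image of
    such a morphism. *)
Lemma subring_type : exists (R : comNzRingType) (i : {rmorphism R -> F}),
  forall x, B x <-> exists r, i r = x.
Proof.
pose S0 : pred F := fun x => `[< B x >].
have S0c : subring_closed S0.
  split=> [|x y /asboolP Bx /asboolP By|x y /asboolP Bx /asboolP By]; apply/asboolP.
  - exact: subring1.
  - exact: subringB.
  - exact: subringM.
pose S : subringClosed F := HB.pack S0 (GRing.isSubringClosed.Build F S0 S0c).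
exists (subring_of S), (\val : {rmorphism subring_of S -> F}) => x; split=> [Bx|[r <-]]; last by have /asboolP := valP r.
have Sx : x \in S by apply/asboolP.
by exists (SubringOf Sx).
Qed.

End SubringTheory.

Definition adjoin (B : set F) (t : F) : set F :=
  [set y | exists p : {poly F}, (forall i, B p`_i) /\ y = p.[t]].

Lemma adjoin_subring B t : is_subring B -> is_subring (adjoin B t).
Proof.
move=> hB; split.
- exists 1; split; last by rewrite hornerC.
  by move=> i; rewrite coef1; case: (i == _); [apply: subring1|apply: subring0].
- move=> _ _ [p [Bp ->]] [q [Bq ->]]; exists (p - q); split; last by rewrite !hornerE.
  by move=> i; rewrite coefB; apply: subringB.
- move=> _ _ [p [Bp ->]] [q [Bq ->]]; exists (p * q); split; last by rewrite hornerM.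
  by move=> i; rewrite coefM; apply: subring_sum => // j _; apply: subringM.
Qed.

Lemma sub_adjoin B t : is_subring B -> B `<=` adjoin B t.
Proof.
move=> hB x Bx; exists x%:P; split; last by rewrite hornerC.
by move=> i; rewrite coefC; case: (i == _) => //; apply: subring0.
Qed.

Lemma adjoin_gen B t : is_subring B -> adjoin B t t.
Proof.
move=> hB; exists 'X; split; last by rewrite hornerX.
by move=> i; rewrite coefX; case: (i == _); [apply: subring1|apply: subring0].
Qed.

Definition localize (B : set F) (b : F) : set F := [set x | exists n, B (x * b ^+ n)].

Lemma localize_subring B b : is_subring B -> B b -> is_subring (localize B b).
Proof.
move=> hB Bb; split.
- by exists 0; rewrite expr0 mulr1; apply: subring1.
- move=> x y [m Bx] [n By]; exists (m + n)%N; rewrite mulrBl exprD.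
  apply: subringB => //; first by rewrite mulrA; apply: subringM => //; apply: subringX.
  by rewrite mulrCA; apply: subringM => //; apply: subringX.
- move=> x y [m Bx] [n By]; exists (m + n)%N.
  by rewrite exprD mulrACA; apply: subringM.
Qed.

Lemma sub_localize B b : is_subring B -> B `<=` localize B b.
Proof. by move=> hB x Bx; exists 0; rewrite expr0 mulr1. Qed.

(* The fraction field of [B] is generated over [B] by one inverse. *)
Definition goldman (B : set F) : Prop :=
  exists b, [/\ B b, b != 0 & forall c, B c -> c != 0 ->
    exists n e, B e /\ c * e = b ^+ n].

Definition algebraic_over (B : set F) (t : F) : Prop :=
  exists p : {poly F}, [/\ p != 0, forall i, B p`_i & p.[t] = 0].

(* Over a transcendental [t], the element [1 + t u] is coprime to [u] but not
   a unit. *)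
Lemma goldman_algebraic B t : is_subring B -> goldman (adjoin B t) ->
  algebraic_over B t.
Proof.
move=> hB [_ [[U [BU ->]] u0 G]]; apply: contrapT => tr.
(* Transcendence of [t] identifies [B[t]] with a polynomial ring, so identities between values at
   [t] lift to polynomials. *)
have inj (p : {poly F}) : (forall i, B p`_i) -> p.[t] = 0 -> p = 0.
  by move=> Bp p0; apply: contrapT => /eqP pn0; apply: tr; exists p.
pose C : {poly F} := 1 + 'X * U.
have U0 : U != 0 by apply: contraNneq u0 => ->; rewrite horner0.
have BC i : B C`_i.
  rewrite coefD coef1 coefXM; apply: subringD => //.
    by case: (i == _); [apply: subring1|apply: subring0].
  by case: (i == _) => //; apply: subring0.
have sC : (1 < size C)%N.
  rewrite /C addrC size_polyDl; last by rewrite size_poly1 mulrC size_mulX // ltnS size_poly_gt0.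
  by rewrite mulrC size_mulX // ltnS size_poly_gt0.
have c0 : C.[t] != 0.
  by apply/eqP => /(inj _ BC) C0; rewrite C0 size_poly0 in sC.
have AC : adjoin B t C.[t] by exists C.
have [n [_ [[E [BE ->]] CE]]] := G _ AC c0.
have {CE} CE : C * E = U ^+ n.
  apply/eqP; rewrite -subr_eq0; apply/eqP/inj; last first.
    by rewrite hornerD hornerN hornerM horner_exp CE subrr.
  have BUn k i : B (U ^+ k)`_i.
    elim: k i => [|k IH] i.
      by rewrite expr0 coef1; case: (i == _); [apply: subring1|apply: subring0].
    by rewrite exprS coefM; apply: subring_sum => // j _; apply: subringM.
  move=> i; rewrite coefB; apply: subringB => //.
  by rewrite coefM; apply: subring_sum => // j _; apply: subringM.
have cop : coprimep C U.
  apply/Bezout_coprimepP; exists (1, - 'X) => /=.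
  by rewrite mul1r mulNr /C addrK eqpxx.
(* [C] divides [U ^+ n] and is coprime to it, hence is constant, against [sC]. *)
have : C %| U ^+ n by rewrite -CE dvdp_mulIl.
move: (coprimep_expr n cop) => /coprimepP/(_ C (dvdpp C)) H /H /eqp_size.
by rewrite size_poly1 => sC1; rewrite sC1 in sC.
Qed.

(** Multiplying a monic equation of degree [n.+1] for [c^-1] by [c ^+ n] expresses [c^-1] as a
    polynomial in [c] over [B]. *)
Lemma integral_inv_mem (B : set F) (R : comNzRingType) (i : {rmorphism R -> F}) c :
  is_subring B -> (forall x, B x <-> exists r, i r = x) ->
  B c -> c != 0 -> integralOver i c^-1 -> B c^-1.
Proof.
move=> hB Bi Bc c0 [p pm]; rewrite /root horner_coef size_map_poly_id0; last first.
  by rewrite (monicP pm) rmorph1 oner_neq0.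
move: (monic_neq0 pm) (monicP pm); rewrite -size_poly_gt0 lead_coefE.
case: (size p) => // n _ /= pn.
rewrite big_ord_recr /= coef_map /= pn rmorph1 mul1r.
case: n {pn} => [|n]; first by rewrite big_ord0 add0r expr0 oner_eq0.
rewrite addrC addr_eq0 => /eqP E.
have -> : c^-1 = c^-1 ^+ n.+1 * c ^+ n.
  by rewrite exprS exprVn -mulrA mulVf ?mulr1 // expf_neq0.
rewrite E mulNr; apply: subringN => //; rewrite mulr_suml.
apply: subring_sum => // j _; rewrite coef_map -mulrA; apply: subringM => //.
  by apply/Bi; exists p`_j.
have jn : (j <= n)%N by rewrite -ltnS.
have -> : c ^+ n = c ^+ j * c ^+ (n - j) by rewrite -exprD subnKC.
rewrite mulrA exprVn mulVf ?expf_neq0 // mul1r.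
exact: subringX.
Qed.

Lemma integral_monic_scaled (B : set F) (R : comNzRingType) (i : {rmorphism R -> F})
    (p : {poly F}) t :
  (forall x, B x <-> exists r, i r = x) ->
  is_subring B -> B (lead_coef p)^-1 -> p != 0 -> (forall k, B p`_k) -> p.[t] = 0 ->
  integralOver i t.
Proof.
move=> Bi hB Bl p0 Bp pt.
have l0 : lead_coef p != 0 by rewrite lead_coef_eq0.
apply: (@integral_root_monic _ _ _ _ ((lead_coef p)^-1 *: p)).
- by rewrite monicE lead_coefZ mulVf.
- by rewrite /root hornerZ pt mulr0.
- apply/integral_poly => k; rewrite coefZ.
  have /Bi[r <-] : B ((lead_coef p)^-1 * p`_k) by apply: subringM.
  exact: integral_id.
Qed.

Lemma integral_horner_mem (B : set F) (R : comNzRingType) (i : {rmorphism R -> F})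
    (p : {poly F}) t :
  (forall x, B x <-> exists r, i r = x) ->
  (forall k, B p`_k) -> integralOver i t -> integralOver i p.[t].
Proof.
move=> Bi Bp it; apply: integral_horner => //; apply/integral_poly => k.
by have /Bi[r <-] := Bp k; exact: integral_id.
Qed.

(** Let [u] be the element whose inversion makes [B[t]] a field. Invert in [B] the leading
    coefficient of an equation of [t] and the constant term of one of [u]. Then [t] and [u^-1]
    become integral, hence so does the inverse of every nonzero [c] in [B], being a polynomial in
    [t] times a power of [u^-1]. An inverse integral over a ring containing [c] lies in that
    ring. *)
Lemma goldman_descent B t : is_subring B -> algebraic_over B t ->
  goldman (adjoin B t) -> goldman B.
Proof.
move=> hB [p [p0 Bp pt]] [_ [[U [BU ->]]]]; set u := U.[t] => u0 G.
set b0 := lead_coef p.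
have Bb0 : B b0 by rewrite /b0 lead_coefE.
have b00 : b0 != 0 by rewrite lead_coef_eq0.
pose B1 := localize B b0; have hB1 : is_subring B1 by exact: localize_subring.
have [R1 [i1 Bi1]] := subring_type hB1.
have BB1 := @sub_localize B b0 hB.
have Vb0 : B1 b0^-1 by exists 1%N; rewrite expr1 mulVf //; apply: subring1.
have it1 : integralOver i1 t.
  by apply: (integral_monic_scaled Bi1 hB1 _ p0 _ pt) => // k; apply: BB1.
have [Q0 mQ0 rQ0] : integralOver i1 u by apply: (integral_horner_mem Bi1) => // k; apply: BB1.
(* A relation of [u] with nonzero constant term makes [u^-1] integral once
   that term is inverted. *)
have [Q [Qu BQ Q00]] : exists Q : {poly F},
    [/\ Q.[u] = 0, forall k, B1 Q`_k & Q`_0 != 0].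
  have : exists Q : {poly F}, [/\ Q != 0, Q.[u] = 0 & forall k, B1 Q`_k].
    exists (map_poly i1 Q0); split; last by move=> k; apply/Bi1; exists Q0`_k; rewrite coef_map.
      by apply: monic_neq0; apply: monic_map.
    exact/eqP.
  case=> Q; move: (leqnn (size Q)); move: {2}(size Q) => m.
  elim: m Q => [|m IH] Q sQ [Qn0 Qu BQ].
    by rewrite -size_poly_eq0 -leqn0 sQ in Qn0.
  have [Q0'|] := eqVneq Q`_0 0; last by exists Q.
  (* A zero constant term lets ['X] be divided out; since [u] is nonzero, it stays a root of the
     quotient. *)
  have EQ : Q = Poly (behead Q) * 'X.
    apply/polyP => -[|k]; rewrite coefMX ?Q0' //=.
    by rewrite coef_Poly nth_behead.
  apply: (IH (Poly (behead Q))).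
    by apply: leq_trans (size_Poly _) _; rewrite size_behead -ltnS; case: (size Q) sQ.
  split.
  - by apply: contraNneq Qn0 => E; rewrite EQ E mul0r.
  - move: Qu; rewrite {1}EQ hornerM hornerX => /eqP; rewrite mulf_eq0 (negPf u0) orbF.
    by move/eqP.
  - by move=> k; rewrite coef_Poly nth_behead.
(* The constant term lies only in [B[1/b0]]; [v] is this term with its denominator cleared, so it is
   in [B]. *)
have [M BM] := BQ 0%N; set v := Q`_0 * _ in BM.
have v0 : v != 0 by rewrite mulf_neq0 // expf_neq0.
pose b := b0 * v; have Bb : B b by apply: subringM.
have bn0 : b != 0 by rewrite mulf_neq0.
pose B2 := localize B b; have hB2 : is_subring B2 by exact: localize_subring.
have [R2 [i2 Bi2]] := subring_type hB2.
have BB2 := @sub_localize B b hB.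
have B12 : B1 `<=` B2.
  move=> x [n Bx]; exists n; rewrite /b exprMn mulrA; apply: subringM => //.
  exact: subringX.
have it2 : integralOver i2 t.
  apply: (integral_monic_scaled Bi2 hB2 _ p0 _ pt); first exact: B12.
  by move=> k; apply: BB2.
have iu2 : integralOver i2 u by apply: (integral_horner_mem Bi2) => // k; apply: BB2.
have VQ : B2 (Q`_0)^-1.
  exists 1%N; rewrite expr1 /b /v mulrCA mulKf //.
  by apply: subringM => //; apply: subringX.
have iVu : integralOver i2 u^-1.
  (* The relation [Q.[u] = 0] solved for [u^-1]. *)
  have -> : u^-1 = - (Poly (behead Q)).[u] / Q`_0.
    apply: (mulfI u0); rewrite divff //; apply: (mulIf Q00); rewrite mul1r.
    rewrite -mulrA divfK //.
    have EQ : Q = Poly (behead Q) * 'X + (Q`_0)%:P.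
      apply/polyP => -[|k]; rewrite coefD coefMX coefC /= ?add0r //.
      by rewrite coef_Poly nth_behead addr0.
    move: Qu; rewrite {1}EQ !hornerE => /eqP; rewrite addrC addr_eq0 => /eqP ->.
    by rewrite mulrN mulrC.
  apply: integral_mul.
    apply: integral_opp; apply: (integral_horner_mem Bi2) => // k.
    by rewrite coef_Poly nth_behead; apply: B12.
  by have [r <-] := (Bi2 _).1 VQ; exact: integral_id.
exists b; split=> // c Bc c0.
have [n [_ [[E [BE ->]] ce]]] := G _ (@sub_adjoin B t hB _ Bc) c0.
have iVc : integralOver i2 c^-1.
  have -> : c^-1 = E.[t] * u^-1 ^+ n.
    rewrite exprVn -ce invfM mulrCA divff ?mulr1 //.
    apply: contra_eq_neq ce => ->.
    by rewrite mulr0 eq_sym expf_neq0.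
  apply: integral_mul; first by apply: (integral_horner_mem Bi2) => // k; apply: BB2.
  by elim: n {ce} => [|n IH]; [exact: integral1|rewrite exprS; apply: integral_mul].
have [m Bm] := integral_inv_mem hB2 Bi2 (BB2 _ Bc) c0 iVc.
by exists m, (c^-1 * b ^+ m); rewrite mulrA divff // mul1r.
Qed.

Lemma adjoin_seq_subring B (l : seq F) : is_subring B -> is_subring (foldl adjoin B l).
Proof. by elim: l B => //= t l IH B hB; apply: IH; apply: adjoin_subring. Qed.

Lemma sub_adjoin_seq B (l : seq F) : is_subring B -> B `<=` foldl adjoin B l.
Proof.
elim: l B => [|t l IH] B hB x Bx //=; apply: IH; first exact: adjoin_subring.
exact: sub_adjoin.
Qed.

Lemma adjoin_seq_gen B (l : seq F) t : is_subring B -> t \in l -> foldl adjoin B l t.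
Proof.
elim: l B => //= t' l IH B hB; rewrite in_cons => /orP[/eqP ->|tl].
  apply: sub_adjoin_seq; first exact: adjoin_subring.
  exact: adjoin_gen.
by apply: IH => //; apply: adjoin_subring.
Qed.

Lemma goldman_adjoin_seq B (l : seq F) : is_subring B ->
  goldman (foldl adjoin B l) -> goldman B.
Proof.
elim: l B => //= t l IH B hB G.
have GB : goldman (adjoin B t) by apply: IH => //; apply: adjoin_subring.
exact: goldman_descent hB (goldman_algebraic hB GB) GB.
Qed.

(** Zariski's lemma. The field [F] is obtained from [K[t]] by adjoining [gens], and a field is
    trivially [goldman] with [b = 1]. The property descends to [K[t]], where it forces [t] to be
    algebraic. *)
Lemma fg_field_algebraic (K : fieldType) (f : {rmorphism K -> F}) (gens : seq F) :
  (forall S : set F, (forall a, S (f a)) -> (forall g, g \in gens -> S g) ->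
    (forall a b, S a -> S b -> S (a + b)) ->
    (forall a b, S a -> S b -> S (a * b)) -> forall a, S a) ->
  forall t, exists2 p : {poly K}, p != 0 & (map_poly f p).[t] = 0.
Proof.
move=> fg t; pose B := [set x | exists a, f a = x].
have hB : is_subring B.
  split; first by exists 1; rewrite rmorph1.
  - by move=> _ _ [a <-] [b <-]; exists (a - b); rewrite rmorphB.
  - by move=> _ _ [a <-] [b <-]; exists (a * b); rewrite rmorphM.
have hBt := adjoin_subring t hB.
have hl := adjoin_seq_subring gens hBt.
have G : goldman (foldl adjoin (adjoin B t) gens).
  have all x : foldl adjoin (adjoin B t) gens x.
    apply: fg => [a|g|a b|a b].
    - by apply: sub_adjoin_seq => //; apply: sub_adjoin => //; exists a.
    - exact: adjoin_seq_gen.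
    - exact: subringD.
    - exact: subringM.
  exists 1; split=> //; first exact: oner_neq0.
  by move=> c _ c0; exists 0%N, c^-1; rewrite expr0 divff.
have [p [p0 Bp pt]] := goldman_algebraic hB (goldman_adjoin_seq hBt G).
have [q Eq] : exists q : {poly K}, map_poly f q = p.
  exists (\poly_(i < size p) projT1 (cid (Bp i))).
  apply/polyP => i; rewrite coef_map coef_poly; case: ltnP => ip.
    by case: cid.
  by rewrite /= raddf0 nth_default.
exists q; last by rewrite Eq.
by apply: contraNneq p0 => q0; rewrite -Eq q0 rmorph0.
Qed.

End Goldman.

(** * Finite algebras over a field *)

Section Algebras.
Variables (K : fieldType) (A : comPzRingType) (str : {rmorphism K -> A}).

Definition generates (gens : seq A) : Prop :=
  forall S : set A,
    (forall a, S (str a)) -> (forall g, g \in gens -> S g) ->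
    (forall a b, S a -> S b -> S (a + b)) ->
    (forall a b, S a -> S b -> S (a * b)) ->
    forall a, S a.

(** Being a root of a monic polynomial that splits over [K]; for algebraically closed [K] this is
    integrality over [K]. *)
Definition splits (a : A) : Prop := exists rs : seq K, \prod_(r <- rs) (a - str r) = 0.

Fixpoint kspan (l : seq A) (a : A) : Prop :=
  if l is g :: l' then exists c b, kspan l' b /\ a = str c * g + b else a = 0.

Lemma kspan0 l : kspan l 0.
Proof. by elim: l => //= g l IH; exists 0, 0; rewrite rmorph0 mul0r addr0. Qed.

Lemma kspanD l a b : kspan l a -> kspan l b -> kspan l (a + b).
Proof.
elim: l a b => [|g l IH] a b /=; first by move=> -> ->; rewrite addr0.
move=> [c [a' [la ->]]] [d [b' [lb ->]]]; exists (c + d), (a' + b').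
by split; [exact: IH|rewrite rmorphD mulrDl addrACA].
Qed.

Lemma kspanZ l c a : kspan l a -> kspan l (str c * a).
Proof.
elim: l a => [|g l IH] a /=; first by move=> ->; rewrite mulr0.
move=> [d [b [lb ->]]]; exists (c * d), (str c * b).
by split; [exact: IH|rewrite rmorphM mulrDr mulrA].
Qed.

Lemma kspan_mem l g : g \in l -> kspan l g.
Proof.
elim: l => //= h l IH; rewrite in_cons => /orP[/eqP ->|gl].
  by exists 1, 0; rewrite rmorph1 mul1r addr0; split => //; apply: kspan0.
by exists 0, g; rewrite rmorph0 mul0r add0r; split => //; apply: IH.
Qed.

Lemma kspan_ind (S : set A) l : S 0 -> (forall a b, S a -> S b -> S (a + b)) ->
  (forall c a, S a -> S (str c * a)) -> (forall g, g \in l -> S g) ->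
  forall a, kspan l a -> S a.
Proof.
move=> S0 SD SZ; elim: l => [|g l IH] Sl a /=; first by move=> ->.
move=> [c [b [lb ->]]]; apply: SD.
  by apply: SZ; apply: Sl; rewrite mem_head.
by apply: IH => // h hl; apply: Sl; rewrite in_cons hl orbT.
Qed.

Lemma kspan_sub l l' : {subset l <= l'} -> forall a, kspan l a -> kspan l' a.
Proof.
move=> ll'; apply: kspan_ind; [exact: kspan0|exact: kspanD|exact: kspanZ|].
by move=> g /ll'; exact: kspan_mem.
Qed.

Lemma kspan_coord l a : kspan l a ->
  exists c : 'I_(size l) -> K, a = \sum_(i < size l) str (c i) * l`_i.
Proof.
elim: l a => [|g l IH] a /=; first by move=> ->; exists (fun=> 0); rewrite big_ord0.
move=> [c [b [/IH[d ->] ->]]].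
exists (fun i => if unlift ord0 i is Some j then d j else c).
rewrite big_ord_recl unlift_none /=; congr (_ + _).
by apply: eq_bigr => i _; rewrite liftK.
Qed.

Section Tower.
Variables (g : A) (l : seq A).

(* Newton basis: the products of initial segments of [prod (g - r)]. *)
Fixpoint newton (rs : seq K) (e : A) : seq A :=
  if rs is r :: rs' then [seq e * m | m <- l] ++ newton rs' (e * (g - str r)) else [::].

(** The vanishing hypothesis takes care of the empty list of roots, where it reads [e = 0]. *)
Lemma newton_head rs e m : e * \prod_(r <- rs) (g - str r) = 0 -> kspan l m ->
  kspan (newton rs e) (e * m).
Proof.
case: rs => [|r rs] /=; first by rewrite big_nil mulr1 => -> _; rewrite mul0r.
move=> _; apply: (@kspan_ind (fun m => kspan _ (e * m))).
- by rewrite mulr0; apply: kspan0.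
- by move=> a b ? ?; rewrite (mulrDr _ a b); apply: kspanD.
- by move=> c a ?; rewrite (mulrCA _ (str c)); apply: kspanZ.
- by move=> h hl; apply: kspan_mem; rewrite mem_cat map_f.
Qed.

(** Writing [g = r + (g - r)], multiplication by [g] sends a block to itself plus the next block;
    past the last block the product vanishes. *)
Lemma newton_stable rs e : e * \prod_(r <- rs) (g - str r) = 0 ->
  forall a, kspan (newton rs e) a -> kspan (newton rs e) (g * a).
Proof.
elim: rs e => [|r rs IH] e /=; first by move=> _ a ->; rewrite mulr0.
rewrite big_cons mulrA => E; apply: kspan_ind.
- by rewrite mulr0; apply: kspan0.
- by move=> a b ? ?; rewrite (mulrDr _ a b); apply: kspanD.
- by move=> c a ?; rewrite (mulrCA _ (str c)); apply: kspanZ.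
- move=> h; rewrite mem_cat => /orP[/mapP[m ml ->]|hn].
    have -> : g * (e * m) = str r * (e * m) + e * (g - str r) * m.
      by rewrite mulrBr mulrBl -!mulrA [X in _ + (X - _)]mulrCA [X in _ - X]mulrCA addrC subrK.
    apply: kspanD.
      by apply: kspanZ; apply: kspan_mem; rewrite mem_cat map_f.
    apply: (@kspan_sub (newton rs (e * (g - str r)))).
      by move=> x xn; rewrite mem_cat xn orbT.
    by apply: newton_head => //; apply: kspan_mem.
  apply: (@kspan_sub (newton rs (e * (g - str r)))).
    by move=> x xn; rewrite mem_cat xn orbT.
  by apply: IH => //; apply: kspan_mem.
Qed.

Lemma newton_stable_other rs e h : (forall a, kspan l a -> kspan l (h * a)) ->
  forall a, kspan (newton rs e) a -> kspan (newton rs e) (h * a).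
Proof.
move=> hl; elim: rs e => [|r rs IH] e /=; first by move=> a ->; rewrite mulr0.
apply: kspan_ind.
- by rewrite mulr0; apply: kspan0.
- by move=> a b ? ?; rewrite (mulrDr _ a b); apply: kspanD.
- by move=> c a ?; rewrite (mulrCA _ (str c)); apply: kspanZ.
- move=> x; rewrite mem_cat => /orP[/mapP[m ml ->]|xn].
    rewrite mulrCA; apply: (@kspan_sub [seq e * m | m <- l]).
      by move=> y yn; rewrite mem_cat yn.
    apply: (@kspan_ind (fun m => kspan _ (e * m)) l) (hl _ (kspan_mem ml)).
    + by rewrite mulr0; apply: kspan0.
    + by move=> a b ? ?; rewrite (mulrDr _ a b); apply: kspanD.
    + by move=> c a ?; rewrite (mulrCA _ (str c)); apply: kspanZ.
    + by move=> k kl; apply: kspan_mem; rewrite map_f.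
  apply: (@kspan_sub (newton rs (e * (g - str r)))).
    by move=> y yn; rewrite mem_cat yn orbT.
  by apply: IH; apply: kspan_mem.
Qed.

End Tower.

(** Newton bases, taken for one generator after another, give a finite span containing [1] and
    stable under every generator. The elements preserving this span form a subalgebra, hence are all
    of [A]; apply them to [1]. *)
Lemma splits_finite gens : generates gens -> (forall g, g \in gens -> splits g) ->
  exists l, forall a, kspan l a.
Proof.
move=> fg sp.
have [l l1 lg] : exists2 l, kspan l 1 &
    forall g, g \in gens -> forall a, kspan l a -> kspan l (g * a).
  elim: gens {fg} sp => [|g gens IH] sp; first by exists [:: 1] => //; apply: kspan_mem; rewrite mem_head.
  have [|l l1 lg] := IH; first by move=> h hg; apply: sp; rewrite in_cons hg orbT.
  have [rs rs0] : splits g by apply: sp; rewrite mem_head.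
  have E : 1 * \prod_(r <- rs) (g - str r) = 0 by rewrite mul1r.
  exists (newton g l rs 1); first by rewrite -[X in kspan _ X]mulr1; apply: newton_head.
  move=> h; rewrite in_cons => /orP[/eqP ->|hg]; first exact: newton_stable.
  by apply: newton_stable_other; apply: lg.
exists l => a; rewrite -[a]mulr1; move: l1; move: (1 : A); move: a.
apply: (fg (fun a => forall m, kspan l m -> kspan l (a * m))).
- by move=> c m; apply: kspanZ.
- exact: lg.
- by move=> a b la lb m lm; rewrite mulrDl; apply: kspanD; [apply: la|apply: lb].
- by move=> a b la lb m lm; rewrite -mulrA; apply: la; apply: lb.
Qed.

(** * Primes of an algebra with split elements *)

Lemma str_not_prime (m : set A) c : prime_ideal m -> c != 0 -> ~ m (str c).
Proof.
move=> [_ _ mM m1 _] c0 mc; apply: m1.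
by rewrite -(rmorph1 str) -(mulVf c0) rmorphM; apply: mM.
Qed.

Lemma prime_prod (m : set A) (rs : seq K) a : prime_ideal m ->
  m (\prod_(r <- rs) (a - str r)) -> exists2 r, r \in rs & m (a - str r).
Proof.
move=> mp; have [_ _ _ m1 mM] := mp.
elim: rs => [|r rs IH]; first by rewrite big_nil.
rewrite big_cons => /mM[mr|/IH[s srs ms]]; first by exists r; rewrite ?mem_head.
by exists s; rewrite ?in_cons ?srs ?orbT.
Qed.

(** The vanishing product of the factors [a - r] lies in the prime [m], so one factor does. *)
Lemma splits_residue (m : set A) a : prime_ideal m -> splits a -> exists c, m (a - str c).
Proof.
move=> mp [rs E]; have [m0 _ _ _ _] := mp.
by have [|r _ mr] := @prime_prod m rs a mp; [rewrite E|exists r].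
Qed.

Lemma residue_uniq (m : set A) a c d : prime_ideal m ->
  m (a - str c) -> m (a - str d) -> c = d.
Proof.
move=> mp mc md; apply/eqP; rewrite -subr_eq0; apply: contrapT => /negP cd.
apply: (str_not_prime mp cd).
have -> : str (c - d) = (a - str d) - (a - str c).
  by rewrite rmorphB opprB [RHS]addrC addrA subrK.
by apply: idealB => //; apply: prime_is_ideal.
Qed.

(** Take for [s] the product of the factors with root other than [c], none of which is in [m] by
    uniqueness of the residue, and for [k] the multiplicity of [c]. *)
Lemma splits_kill (m : set A) a c : prime_ideal m -> splits a -> m (a - str c) ->
  exists s k, ~ m s /\ s * (a - str c) ^+ k = 0.
Proof.
move=> mp [rs E] mc; have [m0 mD mM m1 mp'] := mp.
exists (\prod_(r <- rs | r != c) (a - str r)), (count_mem c rs); split.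
  rewrite -big_filter => /(prime_prod mp)[r]; rewrite mem_filter => /andP[rc _] mr.
  by move: rc; rewrite (residue_uniq mp mr mc) eqxx.
rewrite -E [RHS](bigID (fun r => r == c)) /= mulrC; congr (_ * _).
rewrite (eq_bigr (fun=> a - str c)); last by move=> r /eqP ->.
by rewrite big_const_seq iter_mulr_1.
Qed.

Lemma same_residues gens (m m' : set A) : generates gens -> prime_ideal m ->
  prime_ideal m' ->
  (forall g, g \in gens -> exists c, m (g - str c) /\ m' (g - str c)) -> m = m'.
Proof.
move=> fg mp mp' mg.
have H a : exists c, m (a - str c) /\ m' (a - str c).
  have [m0 mD mM _ _] := mp; have [m0' mD' mM' _ _] := mp'.
  move: a; apply: fg => //.
  - by move=> a; exists a; rewrite subrr.
  - move=> a b [c [mc mc']] [d [md md']]; exists (c + d).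
    by rewrite rmorphD opprD addrACA; split; [apply: mD|apply: mD'].
  - move=> a b [c [mc mc']] [d [md md']]; exists (c * d).
    have -> : a * b - str (c * d) = b * (a - str c) + str c * (b - str d).
      by rewrite rmorphM !mulrBr addrA [b * str c]mulrC subrK [b * a]mulrC.
    by split; [apply: mD; apply: mM|apply: mD'; apply: mM'].
(* Membership in a prime means residue [0], so a common residue transfers it from one prime to the
   other. *)
have cc (n n' : set A) a : prime_ideal n -> prime_ideal n' ->
    (exists c, n (a - str c) /\ n' (a - str c)) -> n a -> n' a.
  move=> np np' [c [nc nc']] na.
  have c0 : c = 0.
    by apply: (residue_uniq np nc); rewrite rmorph0 subr0.
  by move: nc'; rewrite c0 rmorph0 subr0.
apply/seteqP; split=> a; first exact: cc.
by apply: cc => //; have [c [? ?]] := H a; exists c.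
Qed.

(** Multiply the elements [s] of [splits_kill] over all generators [g]. A prime missing the product
    contains the powers [(g - c) ^+ k], hence has the same residues as [m] on the generators. *)
Lemma isolating_element gens (m : set A) : generates gens ->
  (forall g, g \in gens -> splits g) -> prime_ideal m ->
  exists s, ~ m s /\ forall m', prime_ideal m' -> ~ m' s -> m = m'.
Proof.
move=> fg sp mp; have [m0 mD mM m1 mP] := mp.
have [s ms sg] : exists2 s, ~ m s & forall g, g \in gens ->
    exists c k, m (g - str c) /\ s * (g - str c) ^+ k = 0.
  elim: gens sp {fg} => [|g gens IH] sp; first by exists 1.
  have [|s ms sg] := IH; first by move=> h hg; apply: sp; rewrite in_cons hg orbT.
  have spg : splits g by apply: sp; rewrite mem_head.
  have [c mc] := splits_residue mp spg.
  have [t [k [mt E]]] := splits_kill mp spg mc.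
  exists (s * t); first by move=> /mP[].
  move=> h; rewrite in_cons => /orP[/eqP ->|/sg[d [j [md Ed]]]].
    by exists c, k; rewrite -mulrA E mulr0.
  by exists d, j; rewrite mulrAC Ed mul0r.
exists s; split=> // m' mp' ms'; apply: (same_residues fg mp mp') => g /sg[c [k [mc E]]].
have [m0' _ _ _ mP'] := mp'.
exists c; split=> //; apply: (prime_ideal_expr (n := k)) => //.
by have := m0'; rewrite -E => /mP'[].
Qed.

(** A prime is determined by the root that it selects for each generator, and each list of roots is
    finite. *)
Lemma finitely_many_primes gens : generates gens ->
  (forall g, g \in gens -> splits g) ->
  exists (T : finType) (phi : set A -> T), forall m m', prime_ideal m ->
    prime_ideal m' -> phi m = phi m' -> m = m'.
Proof.
move=> fg sp.
have [T [phi H]] : exists (T : finType) (phi : set A -> T), forall m m', prime_ideal m ->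
    prime_ideal m' -> phi m = phi m' ->
    forall g, g \in gens -> exists c, m (g - str c) /\ m' (g - str c).
  elim: gens sp {fg} => [|g gens IH] sp; first by exists unit, (fun=> tt).
  have [|T [phi H]] := IH; first by move=> h hg; apply: sp; rewrite in_cons hg orbT.
  have [rs E] : splits g by apply: sp; rewrite mem_head.
  pose f (m : set A) := find (fun r => `[< m (g - str r) >]) rs.
  have fP m : prime_ideal m -> (f m < size rs)%N.
    move=> mp; rewrite -has_find; have [m0 _ _ _ _] := mp.
    have [|r rrs mr] := @prime_prod m rs g mp; first by rewrite E.
    by apply/hasP; exists r => //; apply/asboolP.
  have fM m : prime_ideal m -> m (g - str rs`_(f m)).
    move=> mp; have := fP _ mp; rewrite -has_find => /(nth_find 0).
    by move/asboolP.
  (* [find] returns [size rs] when no root fits, which can happen for sets that are not prime; hence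
     the successor. *)
  exists (T * 'I_(size rs).+1)%type, (fun m => (phi m, inord (f m))).
  move=> m m' mp mp' [Ephi Ef] h; rewrite in_cons => /orP[/eqP ->|]; last exact: H.
  have {}Ef : f m = f m'.
    by move: Ef => /(congr1 val) /=; rewrite !inordK // ltnS ltnW ?fP.
  by exists rs`_(f m); split; [apply: fM|rewrite Ef; apply: fM].
by exists T, phi => m m' mp mp' /H Hg; apply: (same_residues fg mp mp'); apply: Hg.
Qed.

End Algebras.

Lemma zero_dim_splits (K : closedFieldType) (A : comPzRingType)
    (str : {rmorphism K -> A}) (gens : seq A) :
  generates str gens ->
  (forall P Q : set A, prime_ideal P -> prime_ideal Q -> P `<=` Q -> Q `<=` P) ->
  forall a, splits str a.
Proof.
move=> fg dim0 a; apply: contrapT => nsp.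
pose S := [set x | exists rs, x = \prod_(r <- rs) (a - str r)].
have [||||P [Pp _ PS]] := @prime_avoiding A S [set 0].
- by exists [::]; rewrite big_nil.
- by move=> _ _ [rs ->] [ts ->]; exists (rs ++ ts); rewrite big_cat.
- by split=> // [x y -> ->|x y ->]; rewrite ?addr0 ?mulr0.
- by move=> _ [rs ->] E; apply: nsp; exists rs.
have [P0 PD PM P1 PP] := Pp.
have [Q [pi [pis pik]]] := ideal_quotient (prime_is_ideal Pp) P1.
have nz1 : (1 : Q) != 0 by apply/eqP; rewrite -(rmorph1 pi) => /pik.
(* If [b] were not invertible modulo [P], the ideal generated by [P] and [b] would be proper and lie
   in a prime strictly above [P], contradicting [dim0]. *)
have inv (x : Q) : x != 0 -> exists y, y * x = 1.
  have [b <-] := pis x => /eqP b0; have Pb : ~ P b by move/pik.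
  apply: contrapT => ninv.
  pose I := [set y | exists p r, P p /\ y = p + r * b].
  have [||||M [Mp IM _]] := @prime_avoiding A [set 1] I; first by [].
  - by move=> _ _ -> ->; rewrite mulr1.
  - split; first by exists 0, 0; rewrite mul0r addr0.
      move=> _ _ [p [r [Pp' ->]]] [q [t [Pq ->]]]; exists (p + q), (r + t).
      by split; [exact: PD|rewrite mulrDl addrACA].
    move=> c _ [p [r [Pp' ->]]]; exists (c * p), (c * r).
    by split; [exact: PM|rewrite mulrDr mulrA].
  - move=> _ -> [p [r [/pik Pp' E]]]; apply: ninv; exists (pi r).
    by rewrite -rmorphM -(rmorph1 pi) E rmorphD Pp' add0r.
  apply: Pb; apply: (dim0 P M) => //.
    by move=> p Pp'; apply: IM; exists p, 0; rewrite mul0r addr0.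
  by apply: IM; exists 0, 1; rewrite mul1r add0r.
have [F [j [j' jK j'K]]] := comPzRing_field nz1 inv.
pose h : {rmorphism A -> F} := j \o pi.
have hs x : exists b, h b = x.
  by have [b E] := pis (j' x); exists b; rewrite /h /= E j'K.
have hk b : h b = 0 -> P b.
  rewrite /h /= -(rmorph0 j) => /(can_inj jK) /pik //.
pose f : {rmorphism K -> F} := h \o str.
have [S' Sf Sg SD SM x|p p0 pt] := @fg_field_algebraic F K f (map h gens) _ (h a).
  have [b <-] := hs x; apply: (fg (fun b => S' (h b))) => //.
  - by move=> g gg; apply: Sg; rewrite map_f.
  - by move=> b1 b2 ? ?; rewrite rmorphD; apply: SD.
  - by move=> b1 b2 ? ?; rewrite rmorphM; apply: SM.
(* The algebraic relation factors into linear terms over [K], so a product of elements [a - r]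
   vanishes modulo [P], although [P] avoids [S]. *)
have [rs E] := closed_field_poly_normal p.
apply: (PS (\prod_(r <- rs) (a - str r))); first by exists rs.
apply: hk; move/eqP: pt; rewrite E map_polyZ hornerZ mulf_eq0 fmorph_eq0 lead_coef_eq0.
rewrite (negPf p0) /= rmorph_prod horner_prod => /eqP <-; rewrite !rmorph_prod.
by apply: eq_bigr => r _; rewrite !rmorphB /= map_polyX map_polyC !hornerE.
Qed.

(** * Morphisms from one-point schemes *)

Lemma opens_eq (X : topologicalType) (U V : opens X) : oset U = oset V -> U = V.
Proof.
case: U V => [U oU] [V oV] /= E; subst V.
by rewrite (Prop_irrelevance oU oV).
Qed.

(** * Germs that are units *)

Section RingedSpaces.
Variable X : ringedSpace.

Lemma res_res3 (U V W Z : opens X) (hV : V `<=` U) (hW : W `<=` V) (hZ : Z `<=` W)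
    (h : Z `<=` U) (s : sec U) : res hZ (res hW (res hV s)) = res h s.
Proof. by rewrite (res_res _ _ (subset_trans hW hV)) (res_res _ _ h). Qed.

(** The empty family covers an empty open set, so separatedness identifies all sections. *)
Lemma sec_empty (U : opens X) : (forall x, ~ oset U x) -> forall s t : sec U, s = t.
Proof.
move=> U0 s t; pose C (e : Empty_set) : opens X := match e with end.
have hC e : C e `<=` U by case: e.
by apply: (sec_separated (hC := hC)) => [x /U0|[]].
Qed.

Definition opensI (U V : opens X) : opens X :=
  Opens (oset U `&` oset V) (openI (oset_open U) (oset_open V)).

Lemma unit_at1 (U : opens X) x : oset U x -> unit_at (1 : sec U) x.
Proof.
by move=> Ux; exists U, (@subset_refl _ _); split=> //; exists 1; rewrite rmorph1 mulr1.
Qed.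

Lemma unit_at_mem (U : opens X) (s : sec U) x : unit_at s x -> oset U x.
Proof. by move=> [V [h [Vx _]]]; apply: h. Qed.

Lemma unit_at_res (U V : opens X) (h : V `<=` U) (s : sec U) x :
  oset V x -> unit_at (res h s) x <-> unit_at s x.
Proof.
move=> Vx; split=> [[W [k [Wx [t E]]]]|[W [k [Wx [t E]]]]].
  exists W, (subset_trans k h); split=> //; exists t.
  by rewrite -E (res_res _ _ (subset_trans k h)).
have kV : opensI V W `<=` V by move=> y [].
have kW : opensI V W `<=` W by move=> y [].
exists (opensI V W), kV; split; first by split.
exists (res kW t).
rewrite (res_res _ _ (subset_trans kW k)) -(res_res k kW) -rmorphM E.
exact: rmorph1.
Qed.

Lemma unit_atMl (U : opens X) (s t : sec U) x : unit_at (s * t) x -> unit_at s x.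
Proof.
move=> [V [h [Vx [r E]]]]; exists V, h; split=> //; exists (res h t * r).
by rewrite mulrA -rmorphM.
Qed.

Lemma unit_atM (U : opens X) (s t : sec U) x :
  unit_at s x -> unit_at t x -> unit_at (s * t) x.
Proof.
move=> [V [h [Vx [r E]]]] [W [k [Wx [q Eq]]]].
have kV : opensI V W `<=` V by move=> y [].
have kW : opensI V W `<=` W by move=> y [].
exists (opensI V W), (subset_trans kV h); split; first by split.
exists (res kV r * res kW q).
rewrite rmorphM mulrACA -{1}(res_res h kV) -rmorphM E rmorph1 mul1r.
by rewrite -(res_res k kW) -rmorphM Eq rmorph1.
Qed.

Lemma unit_atX (U : opens X) (s : sec U) n x : unit_at s x -> unit_at (s ^+ n) x.
Proof.
move=> sx; elim: n => [|n IH]; first exact/unit_at1/(unit_at_mem sx).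
by rewrite exprS; apply: unit_atM.
Qed.

Lemma inv_unit_at (U : opens X) (s t : sec U) x : oset U x -> s * t = 1 -> unit_at s x.
Proof. by move=> Ux E; apply: (@unit_atMl _ _ t); rewrite E; apply: unit_at1. Qed.

Lemma unit_at_point (U : opens X) (s : sec U) x : oset U = [set x] ->
  unit_at s x -> exists t, s * t = 1.
Proof.
move=> Ux [V [h [Vx [t E]]]].
have UV : V = U.
  by apply: opens_eq; apply/seteqP; split=> // y; rewrite Ux => ->.
by subst V; exists t; rewrite -E res_id.
Qed.

Hypothesis Xlocal : locally_ringed X.

Lemma unit_at_nz (U : opens X) x : oset U x -> ~ unit_at (0 : sec U) x.
Proof.
move=> Ux [V [h [Vx [t]]]]; rewrite rmorph0 mul0r => E.
by have [/eqP] := Xlocal Vx; rewrite E.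
Qed.

(** The maximal ideal of the stalk, pulled back to [sec U]. For sums: if [(a + b) * t = 1] near [x],
    locality makes [a * t] or [1 - a * t = b * t] a unit there. *)
Lemma prime_at (U : opens X) x : oset U x ->
  prime_ideal [set s : sec U | ~ unit_at s x].
Proof.
move=> Ux; split=> /=.
- exact: unit_at_nz.
- move=> a b na nb [V [h [Vx [t E]]]].
  have E' : res h a * t + res h b * t = 1 by rewrite -mulrDl -rmorphD.
  have [_ /(_ (res h a * t))] := Xlocal Vx.
  have -> : 1 - res h a * t = res h b * t by rewrite -E' addrC addKr.
  by move=> [] /unit_atMl /unit_at_res -/(_ Vx).
- by move=> a b nb; rewrite mulrC => /unit_atMl.
- by apply; apply: unit_at1.
- move=> a b nab; apply: contrapT => /not_orP[/contrapT ua /contrapT ub].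
  by apply: nab; apply: unit_atM.
Qed.

Lemma nilpotent_not_unit_at (U : opens X) (s : sec U) n x :
  s ^+ n = 0 -> ~ unit_at s x.
Proof.
move=> E sx; have Ux := unit_at_mem sx.
by apply: (@unit_at_nz U x) => //; rewrite -E; apply: unit_atX.
Qed.

Lemma sec_nonzero (U : opens X) x : oset U x -> (1 : sec U) <> 0.
Proof. by move=> Ux; have [/eqP] := Xlocal Ux. Qed.

End RingedSpaces.

Definition mk_rmorphism (A B : comPzRingType) (f : A -> B)
    (fB : {morph f : x y / x - y}) (f1 : f 1 = 1) (fM : {morph f : x y / x * y}) :
    {rmorphism A -> B} :=
  HB.pack f (GRing.isZmodMorphism.Build A B f fB)
    (GRing.isMonoidMorphism.Build A B f (f1, fM)).

Section Morphisms.
Variable K : fieldType.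
Implicit Types X Y Z T : overScheme K.

Lemma mor_comp_idr X Y (f : mor X Y) : mor_comp f (mor_id X) = f.
Proof.
apply: mor_ext => // V s W hf hg /=.
have h1 : W `<=` opreim (@id_continuous X) (opreim (@mor_cont _ _ _ f) V) := hg.
by rewrite (res_res _ _ h1) (res_res _ _ hg).
Qed.

Lemma mor_compA X Y Z T (h : mor Z T) (g : mor Y Z) (f : mor X Y) :
  mor_comp h (mor_comp g f) = mor_comp (mor_comp h g) f.
Proof.
apply: mor_ext => // V s W h1 h2 /=.
set a := mor_sec h V s; set b := mor_sec g _ a.
set k := @comp_opreim_sub Y Z T _ _ _ _ V.
have k' : opreim (@mor_cont _ _ _ f) (opreim (comp_cont (@mor_cont _ _ _ h) (@mor_cont _ _ _ g)) V)
  `<=` opreim (@mor_cont _ _ _ f) (opreim (@mor_cont _ _ _ g) (opreim (@mor_cont _ _ _ h) V)) by [].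
have h0 : W `<=` opreim (@mor_cont _ _ _ f)
  (opreim (@mor_cont _ _ _ g) (opreim (@mor_cont _ _ _ h) V)) := h1.
by rewrite (mor_res k k') (res_res3 _ _ _ h0) [RHS](res_res3 _ _ _ h0).
Qed.

(** Pullbacks along [f] and [g] live in different types; restriction to a common [W] makes them
    comparable. *)
Lemma pull_congr X Y (f g : mor X Y) (V : opens Y) (W : opens X)
    (hf : W `<=` opreim (@mor_cont _ _ _ f) V) (hg : W `<=` opreim (@mor_cont _ _ _ g) V) s :
  f = g -> res hf (mor_sec f V s) = res hg (mor_sec g V s).
Proof. by move=> E; subst g; rewrite (Prop_irrelevance hf hg). Qed.

Lemma pull_comp X Y Z (i : mor Y Z) (g : mor X Y) (V : opens Z) (M : opens Y) (W : opens X)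
    (h : W `<=` opreim (@mor_cont _ _ _ (mor_comp i g)) V)
    (hM : M `<=` opreim (@mor_cont _ _ _ i) V)
    (hg : W `<=` opreim (@mor_cont _ _ _ g) M) (a : sec V) :
  res h (mor_sec (mor_comp i g) V a) =
  res hg (mor_sec g M (res hM (mor_sec i V a))).
Proof.
have k : opreim (@mor_cont _ _ _ g) M `<=`
  opreim (@mor_cont _ _ _ g) (opreim (@mor_cont _ _ _ i) V) by move=> x; apply: hM.
rewrite (mor_res hM k) /= (res_res _ _ (subset_trans hg k)).
by rewrite (res_res _ _ (subset_trans hg k)).
Qed.

Lemma pull_res X Y (f : mor X Y) (V V' : opens Y) (v : V' `<=` V) (W W' : opens X)
    (w : W' `<=` W)
    (h : W `<=` opreim (@mor_cont _ _ _ f) V') (h' : W' `<=` opreim (@mor_cont _ _ _ f) V) s :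
  res w (res h (mor_sec f V' (res v s))) = res h' (mor_sec f V s).
Proof.
have k : opreim (@mor_cont _ _ _ f) V' `<=` opreim (@mor_cont _ _ _ f) V.
  by move=> x; apply: v.
rewrite (mor_res v k) (res_res _ _ (subset_trans h k)).
by rewrite (res_res _ _ h').
Qed.

(** * Morphisms from a one-point scheme to an open point [x] *)

Section FromPoint.
Variables (T X : overScheme K) (t0 : T) (Ht : forall t, t = t0).
Variables (x : X) (N : opens X) (hN : oset N = [set x]).

Lemma point_sub (V : opens X) : oset V x -> N `<=` V.
Proof. by move=> Vx y; rewrite hN => ->. Qed.

(** [N] is the smallest neighbourhood of [x], so every relevant section can first be restricted to
    [N]. *)
Lemma pt_mor_ext (f g : mor T X)
    (hf : otop T `<=` opreim (@mor_cont _ _ _ f) N)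
    (hg : otop T `<=` opreim (@mor_cont _ _ _ g) N) :
  (forall s, res hf (mor_sec f N s) = res hg (mor_sec g N s)) -> f = g.
Proof.
move=> E.
have fx t : f t = x by have /= := hf t I; rewrite hN.
have gx t : g t = x by have /= := hg t I; rewrite hN.
apply: mor_ext => [t|V s W kf kg]; first by rewrite fx gx.
case: (pselect (oset W t0)) => [Wt|nW]; last first.
  by apply: sec_empty => t; rewrite (Ht t).
have Vx : oset V x by have /= := kf _ Wt; rewrite fx.
rewrite -(pull_res (point_sub Vx) (@otop_sub _ W) hf).
by rewrite -(pull_res (point_sub Vx) (@otop_sub _ W) hg) E.
Qed.

Variable phi : {rmorphism sec N -> sec (otop T)}.
Hypothesis phi_scal : forall a, phi (scal N a) = scal (otop T) a.
Hypothesis phi_local : forall s r, phi s * r = 1 -> exists t, s * t = 1.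

Let cx : continuous (fun _ : T => x).
Proof. exact: cst_continuous. Qed.

(** If [V] misses [x], its preimage is empty and the target is a zero ring, so the default [0] is
    the only value. *)
Let pt_fun (V : opens X) (s : sec V) : sec (opreim cx V) :=
  if pselect (oset V x) is left v
  then res (@otop_sub T (opreim cx V)) (phi (res (point_sub v) s)) else 0.

Let pt_funB V : {morph @pt_fun V : s t / s - t}.
Proof.
by move=> s t; rewrite /pt_fun; case: pselect => v; rewrite ?subr0 // !rmorphB.
Qed.

Let pt_fun1 V : @pt_fun V 1 = 1.
Proof.
rewrite /pt_fun; case: pselect => v; first by rewrite !rmorph1.
by apply: sec_empty.
Qed.

Let pt_funM V : {morph @pt_fun V : s t / s * t}.
Proof.
by move=> s t; rewrite /pt_fun; case: pselect => v; rewrite ?mulr0 // !rmorphM.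
Qed.

Let pt_sec (V : opens X) : {rmorphism sec V -> sec (opreim cx V)} :=
  mk_rmorphism (@pt_funB V) (@pt_fun1 V) (@pt_funM V).

Let pt_res (V W : opens X) (h : W `<=` V) (h' : opreim cx W `<=` opreim cx V) (s : sec V) :
  pt_sec W (res h s) = res h' (pt_sec V s).
Proof.
rewrite /pt_sec /= /pt_fun.
case: (pselect (oset W x)) => Wx; last by apply: sec_empty.
case: (pselect (oset V x)) => [Vx|nV]; last by case: nV; apply: h.
rewrite (res_res _ _ (point_sub Vx)) [RHS](res_res _ _ (@otop_sub T _)) //.
Qed.

Let pt_local (V : opens X) (s : sec V) (t : T) : oset V x ->
  unit_at (pt_sec V s) t -> unit_at s x.
Proof.
move=> Vx; rewrite /pt_sec /= /pt_fun; case: pselect => // v.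
have Vt : oset (opreim cx V) t by [].
move=> /(unit_at_res _ _ Vt).
have T1 : oset (otop T) = [set t] by apply/seteqP; split=> // y _; rewrite (Ht y) (Ht t).
move=> /(unit_at_point T1)[r /phi_local [q E]].
have Nx : oset N x by rewrite hN.
by apply/(unit_at_res (point_sub v) s Nx); apply: inv_unit_at E.
Qed.

Let pt_scal (V : opens X) (a : K) : pt_sec V (scal V a) = scal _ a.
Proof.
rewrite /pt_sec /= /pt_fun; case: pselect => v; last exact: sec_empty.
by rewrite res_scal phi_scal res_scal.
Qed.

Lemma pt_mor_exists : exists f : mor T X,
  (forall t, f t = x) /\
  forall (h : otop T `<=` opreim (@mor_cont _ _ _ f) N) s, res h (mor_sec f N s) = phi s.
Proof.
exists (Mor pt_res pt_local pt_scal); split=> // h s /=.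
rewrite /pt_fun; case: pselect => [v|]; last by case; rewrite hN.
by rewrite (res_res _ _ (@subset_refl _ (oset (otop T)))) !res_id.
Qed.

End FromPoint.

(** Either the zero ring or a local ring whose maximal ideal consists of nilpotents. *)
Definition nil_local (A : comPzRingType) : Prop :=
  forall a : A, (exists b, a * b = 1) \/ exists n, a ^+ n = 0.

Section Factor.
Variables (T X Y : overScheme K) (t0 : T) (Ht : forall t, t = t0) (i : mor Y X).
Variables (x : X) (N : opens X) (hN : oset N = [set x]).
Variables (y : Y) (M : opens Y) (hM : oset M = [set y]).
Variable hMN : M `<=` opreim (@mor_cont _ _ _ i) N.
Hypothesis surj : forall b, exists a, res hMN (mor_sec i N a) = b.

(** The pullback along [f] kills the kernel of the surjection [sec N -> sec M], so it descends to
    [sec M] and defines [g]. *)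
Lemma pt_factor (f : mor T X) (hf : otop T `<=` opreim (@mor_cont _ _ _ f) N) :
  nil_local (sec N) ->
  (forall a, res hMN (mor_sec i N a) = 0 -> res hf (mor_sec f N a) = 0) ->
  exists g : mor T Y, f = mor_comp i g.
Proof.
move=> nil ker.
pose q : {rmorphism sec N -> sec M} := res hMN \o mor_sec i N.
pose p : {rmorphism sec N -> sec (otop T)} := res hf \o mor_sec f N.
pose L b := projT1 (cid (surj b)).
have LK b : q (L b) = b by rewrite /L; case: cid.
have pE a a' : q a = q a' -> p a = p a'.
  move=> /eqP; rewrite -subr_eq0 -rmorphB => /eqP /ker E.
  by apply/eqP; rewrite -subr_eq0 -rmorphB; apply/eqP.
pose phi b := p (L b).
have phiB : {morph phi : s t / s - t}.
  by move=> s t; rewrite /phi -rmorphB; apply: pE; rewrite rmorphB !LK.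
have phi1 : phi 1 = 1 by rewrite /phi -(rmorph1 p); apply: pE; rewrite LK rmorph1.
have phiM : {morph phi : s t / s * t}.
  by move=> s t; rewrite /phi -rmorphM; apply: pE; rewrite rmorphM !LK.
have [||g [gy gE]] := @pt_mor_exists T Y t0 Ht y M hM (mk_rmorphism phiB phi1 phiM).
- move=> a /=; rewrite /phi (pE _ (scal N a)); first by rewrite /p /= mor_scal res_scal.
  by rewrite LK /q /= mor_scal res_scal.
(* Locality: a nilpotent lift would make [phi s] both nilpotent and invertible, hence [1 = 0] on the
   nonempty [T]. *)
- move=> s r /= E; have [[b Eb]|[n En]] := nil (L s).
    by exists (q b); rewrite -[s]LK -rmorphM Eb rmorph1.
  case: (@sec_nonzero T (@os_local _ T) (otop T) t0 I).
  rewrite -(expr1n _ n) -E exprMn /phi -rmorphXn En rmorph0 mul0r //.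
exists g.
have hg : otop T `<=` opreim (@mor_cont _ _ _ g) M by move=> t _ /=; rewrite gy hM.
have hig : otop T `<=` opreim (@mor_cont _ _ _ (mor_comp i g)) N.
  by move=> t _ /=; apply: hMN; rewrite gy hM.
apply: (pt_mor_ext Ht hN (hf := hf) (hg := hig)) => s.
by rewrite (pull_comp hig hMN hg) gE /= /phi; apply: pE; rewrite LK.
Qed.

Lemma pt_mono (g h : mor T Y) : (forall t, g t = y) -> (forall t, h t = y) ->
  mor_comp i g = mor_comp i h -> g = h.
Proof.
move=> gy hy E.
have hg : otop T `<=` opreim (@mor_cont _ _ _ g) M by move=> t _ /=; rewrite gy hM.
have hh : otop T `<=` opreim (@mor_cont _ _ _ h) M by move=> t _ /=; rewrite hy hM.
apply: (pt_mor_ext Ht hM (hf := hg) (hg := hh)) => s.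
have [a <-] := surj s.
have hig : otop T `<=` opreim (@mor_cont _ _ _ (mor_comp i g)) N.
  by move=> t _ /=; apply: hMN; rewrite gy hM.
have hih : otop T `<=` opreim (@mor_cont _ _ _ (mor_comp i h)) N.
  by move=> t _ /=; apply: hMN; rewrite hy hM.
rewrite -(pull_comp hig hMN hg) -(pull_comp hih hMN hh).
exact: pull_congr.
Qed.

End Factor.
End Morphisms.

(** * The spectrum of a finite local algebra *)

Lemma mor_unit_at (K : fieldType) (X Y : overScheme K) (f : mor X Y) (V : opens Y)
    (s : sec V) x : unit_at s (f x) -> unit_at (mor_sec f V s) x.
Proof.
move=> [W [h [Wx [t E]]]].
have h' : opreim (@mor_cont _ _ _ f) W `<=` opreim (@mor_cont _ _ _ f) V by move=> y; apply: h.
exists (opreim (@mor_cont _ _ _ f) W), h'; split=> //; exists (mor_sec f W t).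
by rewrite -(mor_res h h') -rmorphM E rmorph1.
Qed.

Definition scal_morphism (K : fieldType) (X : overScheme K) (U : opens X) :
  {rmorphism K -> sec U} := res (@otop_sub X U) \o os_str X.

Lemma scal_unit_at (K : fieldType) (X : overScheme K) (U : opens X) (c : K) x :
  oset U x -> c != 0 -> unit_at (scal U c) x.
Proof.
move=> Ux c0; apply: (@inv_unit_at _ _ _ (scal U c^-1)) => //.
have -> : scal U c * scal U c^-1 = scal_morphism U (c * c^-1) by rewrite rmorphM.
by rewrite divff // rmorph1.
Qed.

(** Let [y] be in the closure of [x]. Units at [y] are units at [x]. Conversely, let [s] be a unit
    at [x] but not at [y], with residue [c] at [x], necessarily nonzero. Then [s] and [s - c] are
    both nonunits at [y], hence so is [c], which is absurd. Points of an affine open set are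
    separated by units, so [y = x]. *)
Lemma rational_point_closed (K : fieldType) (P : overScheme K) (x : P) :
  (forall (U : opens P) (a : sec U), oset U x -> exists c, ~ unit_at (a - scal U c) x) ->
  closed [set x].
Proof.
move=> rat y cl.
have specializes (B : opens P) : oset B y -> oset B x.
  move=> By; have [|z [/= -> //]] := cl (oset B).
  by apply: open_nbhs_nbhs; split=> //; apply: oset_open.
have [U Uy [inj _ _ _ _]] := os_scheme y.
have Ux := specializes _ Uy.
apply: inj => // s; split=> [/(specializes (basic_open s)) //|sx].
apply: contrapT => nsy.
have [c nc] := rat U s Ux.
have c0 : c != 0.
  apply/eqP => c0; apply: nc; rewrite c0.
  by have -> : scal U 0 = scal_morphism U 0 by []; rewrite rmorph0 subr0.
have ncy : ~ unit_at (s - scal U c) y by move=> /(specializes (basic_open _)).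
apply: (idealB (prime_is_ideal (prime_at (@os_local _ P) Uy)) nsy ncy).
by rewrite opprB addrC subrK; apply: scal_unit_at.
Qed.

Lemma pull_section (K : fieldType) (X P : overScheme K) (p : mor P X) (d : mor X P)
    (U : opens X) (t : sec U)
    (k : U `<=` opreim (@mor_cont _ _ _ d) (opreim (@mor_cont _ _ _ p) U)) :
  mor_comp p d = mor_id X ->
  res k (mor_sec d (opreim (@mor_cont _ _ _ p) U) (mor_sec p U t)) = t.
Proof.
move=> pd.
have h : U `<=` opreim (@mor_cont _ _ _ (mor_comp p d)) U by exact: k.
have h1 : U `<=` opreim (@mor_cont _ _ _ (mor_id X)) U by [].
transitivity (res h (mor_sec (mor_comp p d) U t)); first by rewrite /= (res_res _ _ k).
rewrite (pull_congr h h1 t pd) /= (res_res _ _ (@subset_refl _ (oset U))).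
exact: res_id.
Qed.

Section PointScheme.
Variables (K : fieldType) (A : comPzRingType) (str : {rmorphism K -> A}).
Hypothesis A_nz : (1 : A) != 0.
Hypothesis A_nil : nil_local A.

Let pt : topologicalType := discrete_topology unit.

(** Functions on the proofs of [oset U tt]: a copy of [A] if [U] contains the point, the zero ring
    otherwise. *)
Let psec (U : opens pt) : comPzRingType := (oset U tt -> A).

Let pres_fun (U V : opens pt) (h : V `<=` U) (s : psec U) : psec V :=
  fun v => s (h tt v).

Let pres (U V : opens pt) (h : V `<=` U) : {rmorphism psec U -> psec V}.
Proof.
by refine (@mk_rmorphism (psec U) (psec V) (pres_fun h) _ _ _).
Defined.

Let point_rs : ringedSpace.
Proof.
refine (@RingedSpace pt psec pres _ _ _ _).
- move=> U h s; apply: funext => v /=; rewrite /pres_fun.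
  by congr (s _); apply: Prop_irrelevance.
- move=> U V W hV hW h s; apply: funext => v /=; rewrite /pres_fun.
  by congr (s _); apply: Prop_irrelevance.
- move=> U I C hC cov s t E; apply: funext => v.
  have [i _ Ci] := cov _ v.
  have := congr1 (fun f => f Ci) (E i); rewrite /= /pres_fun.
  by rewrite (Prop_irrelevance (hC i tt Ci) v).
- move=> U I C hC cov s E.
  have ex (v : oset U tt) : exists i, oset (C i) tt by have [i _ Ci] := cov _ v; exists i.
  exists (fun v => let: exist j Cj := cid (ex v) in s j Cj) => i; apply: funext => w /=.
  rewrite /pres_fun; case: cid => j Cj /=.
  pose k : C i `<=` C j := fun u (_ : oset (C i) u) => match u with tt => Cj end.
  exact: (congr1 (fun f => f w) (E j i (C i) k (fun _ h => h))).
Defined.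

Let point_unit (U : opens point_rs) (s : sec U) (v : oset U tt) b :
  s v * b = 1 -> unit_at s tt.
Proof.
move=> E; pose t : sec U := fun _ => b.
apply: (@inv_unit_at point_rs U s t tt v).
by apply: funext => w; rewrite -[RHS]E (Prop_irrelevance w v).
Qed.

Let point_nil (U : opens point_rs) (s : sec U) (v : oset U tt) n :
  s v ^+ n = 0 -> s ^+ n = 0.
Proof.
move=> E; apply: funext => w; rewrite (Prop_irrelevance w v).
by rewrite exprfctE.
Qed.

Let point_local : locally_ringed point_rs.
Proof.
move=> [] U v; split.
  by apply/eqP => /(congr1 (fun f => f v)); apply/eqP.
move=> s; have [[b E]|[n E]] := A_nil (s v); first by left; apply: point_unit E.
(* The geometric series inverts [1 - s] for nilpotent [s]. *)
right; apply: (@point_unit _ _ v (\sum_(i < n) s v ^+ i)).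
have -> : (1 - s) v = 1 - s v by [].
by rewrite -opprB mulNr -subrX1 E sub0r opprK.
Qed.

Let point_top_pt : oset (otop point_rs) = [set tt].
Proof. by apply/seteqP; split=> -[]. Qed.

Let point_sec_nil : nil_local (sec (otop point_rs)).
Proof.
move=> s; have [[b E]|[n E]] := A_nil (s I); last by right; exists n; apply: (point_nil E).
by left; apply: (unit_at_point point_top_pt); apply: (point_unit E).
Qed.

Let point_affine : affine_open (otop point_rs).
Proof.
split.
- by move=> [] [].
- move=> P [P0 PD PM P1 PP]; exists tt => // s; split=> [Ps /(unit_at_point point_top_pt)[t E]|].
    by apply: P1; rewrite -E mulrC; apply: PM.
  move=> ns; have [[b E]|[n E]] := point_sec_nil s.
    by case: ns; apply: inv_unit_at E.
  by apply: (@prime_ideal_expr _ _ _ n); rewrite ?E.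
- move=> V [] _ v; exists 1; split; first exact: unit_at1.
  by move=> [].
- move=> s a E; have [[b Eb]|[n En]] := point_sec_nil s; last by exists n; rewrite En mul0r.
  exists 0%N; rewrite expr0 mul1r; apply: funext => v.
  have u : unit_at s tt by apply: inv_unit_at Eb.
  have := congr1 (fun f => f u) E; rewrite /= /pres_fun.
  by rewrite (Prop_irrelevance (basic_open_sub u) v).
- move=> s b; exists 0%N; rewrite expr0.
  case: (pselect (unit_at s tt)) => u.
    exists (fun _ => b u); rewrite mul1r; apply: funext => v /=.
    by rewrite /pres_fun (Prop_irrelevance u v).
  by exists 0; apply: sec_empty => -[].
Qed.

Let point_str_fun (c : K) : sec (otop point_rs) := fun _ => str c.

Let point_str : {rmorphism K -> sec (otop point_rs)}.
Proof.
refine (@mk_rmorphism K (sec (otop point_rs)) point_str_fun _ _ _).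
- by move=> a b; apply: funext => v; rewrite /point_str_fun rmorphB.
- by apply: funext => v; rewrite /point_str_fun rmorph1.
- by move=> a b; apply: funext => v; rewrite /point_str_fun rmorphM.
Defined.

Let point_scheme : overScheme K.
Proof.
refine (@OverScheme K point_rs point_local _ point_str).
by move=> x; exists (otop point_rs).
Defined.

Hypothesis A_res : forall a : A, exists (c : K) n, (a - str c) ^+ n = 0.
Variable l : seq A.
Hypothesis A_fin : forall a, kspan str l a.

(** The image of the diagonal is at most one point, closed because its residues lie in [K];
    surjectivity on stalks holds because pulling back along [p] and then [d] is the identity. *)
Let point_separated : Defs.separated point_scheme.
Proof.
move=> P p q _ d pd qd; split; first by move=> [] [].
- move=> F _; have cd : closed [set d tt].
    apply: rational_point_closed => U a Ux.
    have [c [n E]] := A_res (mor_sec d U a Ux).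
    exists c => /mor_unit_at; apply: (@nilpotent_not_unit_at _ point_local _ _ n).
    apply: (@point_nil (opreim (@mor_cont _ _ _ d) U) (mor_sec d U (a - scal U c)) Ux).
    rewrite -[RHS]E; congr (_ ^+ _).
    by rewrite rmorphB mor_scal.
  case: (pselect (F tt)) => Ft.
    rewrite (_ : [set d x | x in F] = [set d tt]) //.
    by apply/seteqP; split=> [y [[] Fy <-] //|y ->]; exists tt.
  rewrite (_ : [set d x | x in F] = set0); first exact: closed0.
  by apply/seteqP; split=> // y [[] Fy].
- move=> y U t Uy.
  pose V := opreim (@mor_cont _ _ _ p) U.
  have k : U `<=` opreim (@mor_cont _ _ _ d) V.
    move=> x Ux /=; have -> : p (d x) = mor_comp p d x by [].
    by rewrite pd.
  exists V, (mor_sec p U t), U, (@subset_refl _ _), k; split=> //.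
  by rewrite res_id; apply: pull_section.
Qed.

Let point_finite : finite_over point_scheme.
Proof.
split; first exact: point_affine.
exists (size l), (fun i => fun _ => l`_i) => a.
have [c E] := kspan_coord (A_fin (a I)).
exists c; apply: funext => v; rewrite (Prop_irrelevance v I) E.
rewrite fct_sumE; by apply: eq_bigr.
Qed.

Let point_finite_type : finite_type point_scheme.
Proof.
exists 1%N, (fun=> otop point_scheme); split; last by move=> x; exists ord0.
move=> _; split; first exact: point_affine.
exists [seq (fun _ => g) | g <- l] => S Sc Sg SD SM a.
have H : forall b, kspan str l b -> S (fun _ => b).
  apply: kspan_ind.
  - have -> : (fun=> 0 : A) = scal (otop point_scheme) 0; last exact: Sc.
    by apply: funext => v; exact: esym (rmorph0 str).
  - by move=> x y Sx Sy; exact: (SD _ _ Sx Sy).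
  - move=> c x Sx.
    exact: (SM _ _ (Sc c) Sx).
  - by move=> g gl; apply: Sg; apply: map_f.
have -> : a = fun _ => a I by apply: funext => v; rewrite (Prop_irrelevance v I).
exact: H.
Qed.

Lemma point_fat_exists : exists (z : fatPoint K) (psi : {rmorphism A -> sec (otop z)}),
  bijective psi /\ forall c, psi (str c) = scal (otop z) c.
Proof.
pose ks := KScheme point_separated point_finite_type.
have pt1 : exists x : ks, forall y, y = x by exists tt => -[].
exists (@FatPoint K ks point_finite pt1).
pose psi0 (a : A) : sec (otop point_rs) := fun _ => a.
exists (@mk_rmorphism A (sec (otop point_rs)) psi0 (fun _ _ => erefl) erefl (fun _ _ => erefl)).
split=> //; exists (fun s => s I) => // s.
by apply: funext => v; rewrite /= /psi0 (Prop_irrelevance v I).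
Qed.

End PointScheme.

(** * Zero-dimensional schemes *)

Lemma irreducible_closure1 (X : topologicalType) (x : X) :
  irreducible_set (closure [set x]).
Proof.
have xx : closure [set x] x by apply: subset_closure.
split; first by exists x.
move=> A B cA cB /(_ _ xx)[Ax|Bx]; [left|right].
- by move/closure_id: cA => ->; apply: closure_subset => y ->.
- by move/closure_id: cB => ->; apply: closure_subset => y ->.
Qed.

Lemma closure1P (X : topologicalType) (x y : X) :
  closure [set x] y <-> forall V : opens X, oset V y -> oset V x.
Proof.
split=> [cl V Vy|H B].
  have [|z [/= -> //]] := cl (oset V).
  by apply: open_nbhs_nbhs; split=> //; apply: oset_open.
rewrite nbhsE => -[V [oV Vy] VB]; exists x; split=> //.
by apply: VB; apply: (H (Opens V oV)).
Qed.

(** Specialization nests the closures of the two points, which are irreducible closed sets and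
    therefore equal. *)
Lemma zero_dim_specialization (X : topologicalType) (x y : X) : zero_dim X ->
  (forall V : opens X, oset V y -> oset V x) -> forall V : opens X, oset V x -> oset V y.
Proof.
move=> dX H; apply/closure1P.
have cc z := @closed_closure X [set z]; have ic := @irreducible_closure1 X.
rewrite (dX (closure [set y]) (closure [set x])) //; first exact: subset_closure.
rewrite [X in _ `<=` X](closure_id _).1 //; apply: closure_subset => z ->.
exact/closure1P.
Qed.

Section ZeroDim.
Variables (K : closedFieldType) (X : overScheme K).
Hypothesis dX : zero_dim X.
Variables (U : opens X) (aU : affine_open U) (fU : fg_algebra U).

Let str := scal_morphism U.
Let Xloc := @os_local _ X.

Lemma affine_generates : exists gens, generates str gens.
Proof. by have [gens fg] := fU; exists gens => S; apply: fg. Qed.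

Lemma affine_unit_inj x y : oset U x -> oset U y ->
  [set s : sec U | ~ unit_at s x] = [set s | ~ unit_at s y] -> x = y.
Proof.
move=> Ux Uy E; have [inj _ _ _ _] := aU; apply: inj => // s.
have Es : (~ unit_at s x) = (~ unit_at s y) by exact: (congr1 (fun P => P s) E).
by split=> u; apply: contrapT; [rewrite -Es|rewrite Es].
Qed.

(** Inclusion of primes is specialization of points, which is reversible in dimension zero; this
    supplies the hypothesis of [zero_dim_splits]. *)
Lemma affine_splits a : splits str a.
Proof.
have [gens fg] := affine_generates; apply: (@zero_dim_splits _ _ str gens) => // P Q Pp Qp PQ s.
have [inj pts basis _ _] := aU.
have [x Ux Px] := pts _ Pp; have [y Uy Qy] := pts _ Qp.
move=> /Qy nsy; apply/Px => sx; apply: nsy.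
apply: (@zero_dim_specialization X x y dX _ (basic_open s)) => // V Vy.
have [||t [ty tV]] := basis (opensI U V) y; [by move=> z []|by split|].
suff /tV[] : unit_at t x by [].
by apply: contrapT => /Px /PQ /Qy.
Qed.

Lemma affine_isolated x : oset U x ->
  exists s : sec U, unit_at s = [set x].
Proof.
move=> Ux; have [gens fg] := affine_generates.
have [s [/contrapT sx H]] := isolating_element fg (fun g _ => affine_splits g) (prime_at Xloc Ux).
exists s; apply/seteqP; split=> [y sy|y -> //].
have Uy := unit_at_mem sy.
by apply: affine_unit_inj => //; apply/esym/H => //; apply: prime_at.
Qed.

Lemma affine_finite_points : exists l : seq X, forall x, oset U x -> x \in l.
Proof.
have [gens fg] := affine_generates.
have [T [phi H]] := finitely_many_primes fg (fun g _ => affine_splits g).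
pose m x := [set s : sec U | ~ unit_at s x].
pose pick t : option X := if pselect (exists x, oset U x /\ phi (m x) = t) is left h
  then Some (projT1 (cid h)) else None.
exists (pmap pick (enum T)) => x Ux; rewrite mem_pmap; apply/mapP.
exists (phi (m x)); first by rewrite mem_enum.
rewrite /pick; case: pselect => [h|[]]; last by exists x.
case: cid => y /= [Uy E]; congr Some; apply: affine_unit_inj => //.
by apply: H => //; apply: prime_at.
Qed.

Section AtPoint.
Variables (x : X) (Ux : oset U x) (s : sec U) (sx : unit_at s = [set x]).

Let N := basic_open s.
Let rho : {rmorphism sec U -> sec N} := res (basic_open_sub (s := s)).

(** The product [s * r] is a unit nowhere, so the localization at it is zero and some power of it
    vanishes; on [N] the factor [s] is invertible. *)
Lemma isolated_nilpotent r : ~ unit_at r x -> exists n, rho r ^+ n = 0.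
Proof.
move=> rx; have [_ _ _ loc _] := aU.
have [|n] := loc (s * r) 1.
  apply: sec_empty => y sry.
  have sy : unit_at s y := unit_atMl sry.
  apply: rx; move: sy; rewrite sx => <-.
  by apply: (@unit_atMl _ _ _ s); rewrite mulrC.
rewrite mulr1 exprMn => E; exists n.
have [|t Et] := @unit_at_point X N (rho s) x sx; first by apply/unit_at_res; rewrite /= sx.
rewrite -[LHS]mul1r -[X in X * _](expr1n _ n) -Et exprMn mulrAC -rmorphXn -rmorphXn.
by rewrite -rmorphM E rmorph0 mul0r.
Qed.

Lemma affine_residue r : exists c, ~ unit_at (r - scal U c) x.
Proof. exact: (splits_residue (prime_at Xloc Ux) (affine_splits r)). Qed.

(** A section on [N] is a fraction with denominator a power of [s]. On [N], [s] is a nonzero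
    constant times [1 - w] with [w] nilpotent, so its inverse already comes from [sec U]. *)
Lemma isolated_surj b : exists r, rho r = b.
Proof.
have [_ _ _ _ loc] := aU; have [n [a E]] := loc s b.
have [c ncx] := affine_residue s.
have sx' : unit_at s x by rewrite sx.
have c0 : c != 0.
  apply/eqP => c0; apply: ncx; rewrite c0.
  by rewrite (rmorph0 str : scal U 0 = 0) subr0.
pose w := - str c^-1 * (s - str c).
have [|k wk] := @isolated_nilpotent w.
  by rewrite /w mulrC => /unit_atMl.
have sw : s = str c * (1 - w).
  rewrite /w mulNr opprK mulrDr mulr1 mulrA -rmorphM divff // rmorph1 mul1r.
  by rewrite addrC subrK.
pose q := str c^-1 * \sum_(i < k) w ^+ i.
have sq : rho s * rho q = 1.
  rewrite -rmorphM sw /q mulrACA -rmorphM divff // rmorph1 mul1r.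
  rewrite -opprB mulNr -subrX1 opprB rmorphB rmorph1 rmorphXn wk subr0 //.
exists (q ^+ n * a); rewrite rmorphM rmorphXn [rho a]E mulrA -exprMn.
by rewrite [rho q * _]mulrC sq expr1n mul1r.
Qed.

Lemma isolated_nil_local : nil_local (sec N).
Proof.
move=> b; have [r <-] := isolated_surj b.
case: (pselect (unit_at r x)) => rx; last by right; apply: isolated_nilpotent.
left; apply: (@unit_at_point X N _ x sx); apply/unit_at_res => //.
by rewrite /= sx.
Qed.

Lemma isolated_residue (b : sec N) : exists c n, (b - scal N c) ^+ n = 0.
Proof.
have [r <-] := isolated_surj b; have [c nc] := affine_residue r.
have [n E] := isolated_nilpotent nc.
by exists c, n; rewrite -E rmorphB; congr ((_ - _) ^+ _); rewrite /rho res_scal.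
Qed.

Lemma isolated_finite : exists l, forall b, kspan (scal_morphism N) l b.
Proof.
have [gens fg] := affine_generates.
have [l H] := splits_finite fg (fun g _ => affine_splits g).
exists (map rho l) => b; have [r <-] := isolated_surj b.
apply: (@kspan_ind _ _ str (fun r => kspan _ _ (rho r)) l) (H r).
- by rewrite rmorph0; apply: kspan0.
- by move=> u v ? ?; rewrite rmorphD; apply: kspanD.
- move=> c u lu; rewrite rmorphM.
  have -> : rho (str c) = scal_morphism N c by exact: res_scal.
  exact: kspanZ.
- by move=> g gl; apply: kspan_mem; apply: map_f.
Qed.

End AtPoint.
End ZeroDim.

Section ZeroDimScheme.
Variables (K : closedFieldType) (X : kscheme K).
Hypothesis dX : zero_dim X.

Lemma zero_dim_point (x : X) : exists N : opens X,
  [/\ oset N = [set x], nil_local (sec N),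
      forall b : sec N, exists c n, (b - scal N c) ^+ n = 0
    & exists l, forall b, kspan (scal_morphism N) l b].
Proof.
have [n [C [Caff cov]]] := ks_finite_type X; have [i Cx] := cov x.
have [aU fU] := Caff i; have [s sx] := affine_isolated dX aU fU Cx.
exists (basic_open s); split=> //.
- exact: isolated_nil_local aU fU _ Cx _ sx.
- exact: isolated_residue aU fU _ Cx _ sx.
- exact: isolated_finite aU fU _ Cx _ sx.
Qed.

Lemma zero_dim_finite : exists l : seq X, forall x, x \in l.
Proof.
have [n [C [Caff cov]]] := ks_finite_type X.
pose l i := projT1 (cid (affine_finite_points dX (Caff i).1 (Caff i).2)).
exists (flatten [seq l i | i <- enum 'I_n]) => x; have [i Cx] := cov x.
apply/flattenP; exists (l i); first by rewrite map_f // mem_enum.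
by rewrite /l; case: cid => li /= ->.
Qed.

Lemma zero_dim_closed1 (x : X) : closed [set x].
Proof.
move=> y /closure1P H; have [N [Ny _ _ _]] := zero_dim_point y.
by have /= := H N; rewrite Ny => /(_ erefl).
Qed.

End ZeroDimScheme.

(** * Principal sieves *)

Lemma res_eq0 (X : ringedSpace) (U V : opens X) (h : V `<=` U) (h' : U `<=` V) (s : sec U) :
  res h s = 0 -> s = 0.
Proof.
move=> E; have := res_res h h' (@subset_refl _ _) s.
by rewrite res_id E rmorph0.
Qed.

Section Principal.
Variables (K : closedFieldType) (X : kscheme K).

(** No ideal condition is imposed: the sections killed by a morphism form ideals anyway, and
    conditions can be combined by uniting families. *)
Definition section_family := forall V : opens X, set (sec V).

Definition kills (z : fatPoint K) (f : mor z X) (x : X) (I : section_family) : Prop :=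
  (forall t, f t = x) /\ forall V s, I V s -> mor_sec f V s = 0.

Lemma kills_comp (z w : fatPoint K) (g : mor w z) (f : mor z X) x I :
  kills f x I -> kills (mor_comp f g) x I.
Proof.
move=> [fx fI]; split=> [t|V s Is]; first exact: fx.
by rewrite /= fI // rmorph0 rmorph0.
Qed.

Hypothesis dX : zero_dim X.

(* Either the ideal generated by [I] at [x] contains [1], or [I] cuts out the
   spectrum of a quotient of the local ring at [x]. *)
Lemma kills_represented x I :
  (forall (z : fatPoint K) (f : mor z X), ~ kills f x I) \/
  exists (w : fatPoint K) (i : mor w X),
    [/\ closed_immersion i,
        forall (z : fatPoint K) (g h : mor z w), mor_comp i g = mor_comp i h -> g = h
      & forall (z : fatPoint K) (f : mor z X),
          kills f x I <-> exists g, f = mor_comp i g].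
Proof.
have [N [hN nilN resN [l spanN]]] := zero_dim_point dX x.
(* The ideal of [sec N] generated by the restrictions of members of [I]. *)
pose J : set (sec N) := [set a | forall J' : set (sec N), is_ideal J' ->
  (forall (V : opens X) (v : N `<=` V) s, I V s -> J' (res v s)) -> J' a].
have Jid : is_ideal J.
  split=> [J' [] //|a b Ja Jb J' J'id HJ'|a b Jb J' J'id HJ'].
    by have [_ D _] := J'id; apply: D; [apply: Ja|apply: Jb].
  by have [_ _ M] := J'id; apply: M; apply: Jb.
have JI (V : opens X) (v : N `<=` V) s : I V s -> J (res v s) by move=> Is J' _; apply.
have killsJ (z : fatPoint K) (f : mor z X) (hf : otop z `<=` opreim (@mor_cont _ _ _ f) N) a :
    kills f x I -> J a -> res hf (mor_sec f N a) = 0.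
  move=> [fx fI] Ja; apply: (Ja [set b | res hf (mor_sec f N b) = 0]) => [|V v s Is /=].
    split=> /= [|b c Eb Ec|b c Ec]; first by rewrite !rmorph0.
      by rewrite !rmorphD Eb Ec addr0.
    by rewrite !rmorphM Ec mulr0.
  have h' : otop z `<=` opreim (@mor_cont _ _ _ f) V by move=> t Tt /=; apply/v/hf.
  have := pull_res v (@subset_refl _ (oset (otop z))) hf h' s.
  by rewrite res_id (fI _ _ Is) rmorph0.
have fxN (z : fatPoint K) (f : mor z X) : (forall t, f t = x) ->
    otop z `<=` opreim (@mor_cont _ _ _ f) N.
  by move=> fx t _; rewrite /= fx hN.
have [J1|J1] := pselect (J 1).
  left=> z f kf; have hf := fxN _ _ kf.1.
  have := killsJ _ _ hf _ kf J1; rewrite !rmorph1.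
  by have [t _] := fp_point z; apply: (@sec_nonzero z (@os_local _ z) _ t).
right; have [Q [pi [pis pik]]] := ideal_quotient Jid J1.
have Q1 : (1 : Q) != 0 by apply/eqP; rewrite -(rmorph1 pi) => /pik.
have nilQ : nil_local Q.
  move=> q; have [a <-] := pis q; have [[b E]|[n E]] := nilN a.
    by left; exists (pi b); rewrite -rmorphM E rmorph1.
  by right; exists n; rewrite -rmorphXn E rmorph0.
pose strQ : {rmorphism K -> Q} := pi \o scal_morphism N.
have resQ (q : Q) : exists (c : K) n, (q - strQ c) ^+ n = 0.
  have [a <-] := pis q; have [c [n E]] := resN a; exists c, n.
  by rewrite /strQ /= -rmorphB -rmorphXn E rmorph0.
have spanQ q : kspan strQ (map pi l) q.
  have [a <-] := pis q.
  apply: (@kspan_ind _ _ (scal_morphism N) (fun a => kspan strQ _ (pi a)) l) (spanN a).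
  - by rewrite rmorph0; apply: kspan0.
  - by move=> u v ? ?; rewrite rmorphD; apply: kspanD.
  - by move=> c u lu; rewrite rmorphM; apply: (kspanZ (str := strQ)).
  - by move=> g gl; apply: kspan_mem; apply: map_f.
(* [w] is the spectrum of the quotient [Q] of [sec N] by [J], and [i] below is dual to the
   projection onto [Q]. *)
have [w [psi [[psi' psiK psi'K] psi_scal]]] := point_fat_exists Q1 nilQ resQ spanQ.
have [t0 Ht] := fp_point w.
pose phi : {rmorphism sec N -> sec (otop w)} := psi \o pi.
have w_nz : (1 : sec (otop w)) <> 0 by apply: (@sec_nonzero w (@os_local _ w) _ t0).
have phi_scal a : phi (scal N a) = scal (otop w) a by exact: psi_scal.
have phi_local s r : phi s * r = 1 -> exists t, s * t = 1.
  move=> E; have [//|[n En]] := nilN s; case: w_nz.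
  by rewrite -(expr1n _ n) -E exprMn -rmorphXn En rmorph0 mul0r.
have [i [ix iE]] := pt_mor_exists Ht hN phi_scal phi_local.
have hi := fxN _ _ ix.
have phis b : exists a, res hi (mor_sec i N a) = b.
  by have [a Ea] := pis (psi' b); exists a; rewrite iE /phi /= Ea psi'K.
have phik a : res hi (mor_sec i N a) = 0 -> J a.
  by rewrite iE /phi /= -(rmorph0 psi) => /(can_inj psiK) /pik.
have w1 : oset (otop w) = [set t0] by apply/seteqP; split=> // t _; exact: Ht.
have ki : kills i x I.
  split=> // V s Is; have [Vx|nVx] := pselect (oset V x); last first.
    by apply: sec_empty => t /=; rewrite ix.
  have v : N `<=` V by move=> y; rewrite hN => ->.
  have h' : otop w `<=` opreim (@mor_cont _ _ _ i) V by move=> t _ /=; rewrite ix.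
  apply: (@res_eq0 _ _ _ h'); first by [].
  rewrite -(pull_res v (@subset_refl _ (oset (otop w))) hi) res_id iE /phi /=.
  by rewrite (pik _).2 ?rmorph0 //; apply: JI.
exists w, i; split.
- split; first by move=> a b _; rewrite (Ht a) (Ht b).
    move=> F _; have [Ft|nFt] := pselect (F t0).
      rewrite (_ : [set i y | y in F] = [set x]); first exact: zero_dim_closed1.
      by apply/seteqP; split=> [y [t _ <-]|y ->]; [exact: ix|exists t0].
    rewrite (_ : [set i y | y in F] = set0); first exact: closed0.
    by apply/seteqP; split=> // y [t]; rewrite (Ht t).
  move=> y U t Uy; have EU : U = otop w.
    by apply: opens_eq; apply/seteqP; split=> // u _; rewrite (Ht u) -(Ht y).
  subst U; have [a Ea] := phis t.
  by exists N, a, (otop w), (@subset_refl _ _), hi; rewrite res_id.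
- move=> z g h; have [s0 Hs] := fp_point z.
  by apply: (pt_mono Hs w1 phis) => t; apply: Ht.
- move=> z f; have [s0 Hs] := fp_point z; split=> [kf|[g ->]]; last exact: kills_comp.
  apply: (pt_factor Hs hN w1 phis (hf := fxN _ _ kf.1) nilN) => a /phik.
  exact: killsJ.
Qed.

(** Over an open point, surjectivity on stalks becomes surjectivity of [sec N] onto the sections of
    the fibre, so [pt_factor] applies. If [x] is not in the image, [1] lies in the kernel over [N]
    and nothing can be killed. *)
Lemma closed_immersion_kills (Y : kscheme K) (i : mor Y X) (z : fatPoint K) (f : mor z X) x :
  closed_immersion i -> (forall t, f t = x) ->
  (exists g, f = mor_comp i g) <-> kills f x (fun V => [set s | mor_sec i V s = 0]).
Proof.
move=> [inj _ stalk] fx; split=> [[g E]|[_ kf]].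
  split=> // V s /= is0; subst f.
  by rewrite /= is0 rmorph0 rmorph0.
have [N [hN nilN _ _]] := zero_dim_point dX x.
have [t0 Ht] := fp_point z.
have hf : otop z `<=` opreim (@mor_cont _ _ _ f) N by move=> t _ /=; rewrite fx hN.
have [[y iy]|ny] := pselect (exists y, i y = x); last first.
  have i1 : mor_sec i N 1 = 0.
    by apply: sec_empty => y /=; rewrite hN => iy; apply: ny; exists y.
  have := kf N 1 i1; rewrite rmorph1 => E.
  case: (@sec_nonzero z (@os_local _ z) (opreim (@mor_cont _ _ _ f) N) t0) => //.
  by rewrite /= fx hN.
pose M := opreim (@mor_cont _ _ _ i) N.
have hM : oset M = [set y].
  by apply/seteqP; split=> [u|u -> /=]; rewrite /= hN //= -iy => /inj.
have surj (b : sec M) : exists a, res (@subset_refl _ (oset M)) (mor_sec i N a) = b.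
  have My : oset M y by rewrite hM.
  have [V [s [W [hU [hV [Wy E]]]]]] := stalk y M b My.
  have EW : W = M.
    by apply: opens_eq; apply/seteqP; split=> // u; rewrite hM => ->.
  subst W.
  have v : N `<=` V by move=> u; rewrite hN => ->; rewrite -iy; exact: (hV).
  exists (res v s); have := pull_res v (@subset_refl _ (oset M)) (@subset_refl _ (oset M)) hV s.
  by rewrite [LHS]res_id => ->; rewrite E res_id.
apply: (pt_factor Ht hN hM surj (hf := hf) nilN) => a; rewrite res_id => ia.
by rewrite kf // rmorph0.
Qed.

Fixpoint killed_by (L : seq (X * section_family)) (z : fatPoint K) (f : mor z X) : Prop :=
  if L is p :: L' then kills f p.1 p.2 \/ killed_by L' f else False.

Lemma killed_by_map (T : eqType) (F : T -> X * section_family) (s : seq T)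
    (z : fatPoint K) (f : mor z X) :
  killed_by (map F s) f <-> exists2 t, t \in s & kills f (F t).1 (F t).2.
Proof.
elim: s => [|t s IH] /=; first by split=> // -[].
split=> [[kt|/IH[u us ku]]|[u]].
- by exists t; rewrite ?mem_head.
- by exists u; rewrite ?in_cons ?us ?orbT.
- by rewrite in_cons => /orP[/eqP -> kt|us ku]; [left|right; apply/IH; exists u].
Qed.

(** A morphism from a fat point has a single image point, so each closed subscheme breaks up over
    the finitely many points of [X]. *)
Lemma schemic_killed_by (S : sieve X) : schemic S ->
  exists L, forall (z : fatPoint K) (f : mor z X), S z f <-> killed_by L f.
Proof.
move=> [n [Y [i [ci HS]]]]; have [l Hl] := zero_dim_finite dX.
pose F (p : 'I_n * X) : X * section_family :=
  (p.2, fun V => [set s | mor_sec (i p.1) V s = 0]).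
exists (map F [seq (k, x) | k <- enum 'I_n, x <- l]) => z f.
have [t0 Ht] := fp_point z.
have fx t : f t = f t0 by rewrite (Ht t).
rewrite HS killed_by_map; split=> [[k /(closed_immersion_kills (ci k) fx) kf]|[[k x] _ kf]].
  by exists (k, f t0) => //; apply/allpairsP; exists (k, f t0); rewrite /= mem_enum.
by exists k; apply/(closed_immersion_kills (ci k) kf.1).
Qed.

Definition killed_sieve (L : seq (X * section_family)) : sieve X.
Proof.
refine (@Sieve K X (fun z f => killed_by L f) _).
move=> z w g f; elim: L => //= p L IH [kf|/IH]; last by right.
by left; apply: kills_comp.
Defined.

Lemma schemic_empty (S : sieve X) : (forall z f, ~ S z f) -> schemic S.
Proof.
move=> S0; exists 0%N, (fun=> X), (fun=> mor_id X); split; first by case.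
by move=> z f; split=> [/S0 //|[[]]].
Qed.

Lemma schemic_union (S T : sieve X) : schemic S -> schemic T -> schemic (sieve_union S T).
Proof.
move=> [m [Y [i [ci HS]]]] [n [Z [j [cj HT]]]].
pose W (k : 'I_(m + n)) : kscheme K :=
  match fintype.split k with inl a => Y a | inr b => Z b end.
pose u (k : 'I_(m + n)) : mor (W k) X :=
  match fintype.split k as s return
    mor (match s with inl a => Y a | inr b => Z b end : kscheme K) X with
  | inl a => i a | inr b => j b end.
exists (m + n)%N, W, u; split.
  by move=> k; rewrite /W /u; case: fintype.split.
move=> z f; split=> /=.
  move=> [/HS[a [g ->]]|/HT[b [g ->]]].
    by exists (unsplit (inl a)); rewrite /W /u unsplitK; exists g.
  by exists (unsplit (inr b)); rewrite /W /u unsplitK; exists g.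
move=> [k]; rewrite /W /u; case: fintype.split => [a [g E]|b [g E]].
  by left; apply/HS; exists a, g.
by right; apply/HT; exists b, g.
Qed.

Lemma sieve_ext (S T : sieve X) : (forall z f, S z f <-> T z f) -> S = T.
Proof.
case: S T => [S Sc] [T Tc] /= E.
have ST : S = T.
  by apply: functional_extensionality_dep => z; apply: funext => f; apply/propext.
by subst T; rewrite (Prop_irrelevance Sc Tc).
Qed.

Lemma schemic_killed_sieve L : schemic (killed_sieve L).
Proof.
elim: L => [|p L IH]; first by apply: schemic_empty => z f.
rewrite (_ : killed_sieve (p :: L) = sieve_union (killed_sieve [:: p]) (killed_sieve L)).
  apply: schemic_union => //.
  have [none|[w [i [ci _ H]]]] := kills_represented p.1 p.2.
    by apply: schemic_empty => z f /= [/none|].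
  exists 1%N, (fun=> w : kscheme K), (fun=> i); split=> // z f /=.
  split=> [[/H[g E]|//]|[_ [g E]]]; first by exists ord0, g.
  by left; apply/H; exists g.
by apply: sieve_ext => z f /=; split=> [[|]|[[|//]|]]; tauto.
Qed.

(* If the points differ, the added condition kills [1], so nothing remains. *)
Definition meet_family (p q : X * section_family) : X * section_family :=
  (p.1, fun V s => [\/ p.2 V s, q.2 V s | p.1 <> q.1]).

Lemma kills_meet (z : fatPoint K) (f : mor z X) p q :
  kills f (meet_family p q).1 (meet_family p q).2 <->
  kills f p.1 p.2 /\ kills f q.1 q.2.
Proof.
split=> [[fp fI]|[[fp fI] [fq fJ]]].
  have [t0 _] := fp_point z.
  have pq : p.1 = q.1.
    apply: contrapT => npq; have /= := fI (otop X) 1 (Or33 _ _ npq).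
    rewrite rmorph1; apply: (@sec_nonzero z (@os_local _ z) _ t0).
    by [].
  split; first by split=> // V s Is; apply: fI; apply: Or31.
  by split=> [t|V s Js]; [rewrite -pq; exact: fp|apply: fI; apply: Or32].
split=> // V s [Is|Js|npq]; [exact: fI|exact: fJ|].
have [t0 _] := fp_point z.
by case: npq; rewrite -(fp t0) -(fq t0).
Qed.

Lemma killed_meet p L (z : fatPoint K) (f : mor z X) :
  killed_by (map (meet_family p) L) f <-> kills f p.1 p.2 /\ killed_by L f.
Proof.
elim: L => [|q L IH] /=; first by split=> // -[].
by rewrite kills_meet IH; tauto.
Qed.

End Principal.

(** * Presentations and monic elements *)

Section Presentations.
Variables (T : Type) (R : formal_sum T -> Prop).
Local Notation "c ~ d" := (present_eq R c d) (at level 70).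

Definition fscale (m : int) (c : formal_sum T) : formal_sum T :=
  [seq (m * p.1, p.2) | p <- c].

Lemma present_catr c d e : d ~ e -> c ++ d ~ c ++ e.
Proof. by apply: PresentAdd; apply: PresentRefl. Qed.

Lemma present_catl c d e : d ~ e -> d ++ c ~ e ++ c.
Proof. by move=> H; apply: PresentAdd => //; apply: PresentRefl. Qed.

Lemma present_cons p d e : d ~ e -> p :: d ~ p :: e.
Proof. exact: (@present_catr [:: p]). Qed.

Lemma fscaleD m n c : fscale (m + n) c ~ fscale m c ++ fscale n c.
Proof.
elim: c => [|[k x] c IH] /=; first exact: PresentRefl.
apply: PresentTrans (_ : [:: (m * k, x); (n * k, x)] ++ (fscale m c ++ fscale n c) ~ _).
  rewrite mulrDl; apply: (@PresentAdd _ _ [:: _]) IH.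
  by apply: PresentSym; apply: PresentMerge.
rewrite /=; apply: present_cons.
have -> : (n * k, x) :: fscale m c ++ fscale n c = ([:: (n * k, x)] ++ fscale m c) ++ fscale n c by [].
apply: PresentTrans (present_catl _ (PresentComm R _ _)) _.
by rewrite -catA; apply: PresentRefl.
Qed.

Lemma fscale0 c : fscale 0 c ~ [::].
Proof.
elim: c => [|[k x] c IH] /=; first exact: PresentRefl.
by rewrite mul0r; apply: (@PresentAdd _ _ [:: _] [::]) IH; apply: PresentZero.
Qed.

Lemma fscale1 c : fscale 1 c = c.
Proof. by rewrite /fscale -[RHS]map_id; apply: eq_map => -[k x]; rewrite mul1r. Qed.

Lemma fscaleNr c : c ++ fscale (-1) c ~ [::].
Proof.
rewrite -{1}(fscale1 c); apply: PresentTrans (PresentSym (fscaleD _ _ _)) _.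
by rewrite subrr; apply: fscale0.
Qed.

Lemma present_opp c d : c ++ d ~ [::] -> c ~ fscale (-1) d.
Proof.
move=> H; rewrite -[X in X ~ _]cats0.
apply: PresentTrans (present_catr _ (PresentSym (fscaleNr d))) _.
by rewrite catA -[X in _ ~ X]cat0s; apply: present_catl.
Qed.

Lemma present_sub c d : c ++ fscale (-1) d ~ [::] -> c ~ d.
Proof.
move/present_opp; rewrite /fscale -map_comp; congr (_ ~ _).
by rewrite -[RHS]map_id; apply: eq_map => -[m x]; rewrite /= !mulN1r opprK.
Qed.

Lemma fscale_opp_cong c d : c ~ d -> fscale (-1) c ~ fscale (-1) d.
Proof.
move=> H; apply: present_opp; apply: PresentTrans (present_catr _ (PresentSym H)) _.
by apply: PresentTrans (PresentComm _ _ _) _; apply: fscaleNr.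
Qed.

(** Scaling is not a rule of the congruence; it is rebuilt from addition and negation by induction
    on [m]. *)
Lemma fscale_cong m c d : c ~ d -> fscale m c ~ fscale m d.
Proof.
move=> H; elim/int_rect: m => [|n IH|n IH].
- apply: PresentTrans (fscale0 _) _; apply: PresentSym; exact: fscale0.
- rewrite -addn1 PoszD; apply: PresentTrans (fscaleD _ _ _) _.
  apply: PresentTrans (_ : _ ~ fscale n d ++ fscale 1 d) _.
    by rewrite !fscale1; apply: PresentAdd.
  by apply: PresentSym; apply: fscaleD.
- rewrite -addn1 PoszD opprD; apply: PresentTrans (fscaleD _ _ _) _.
  apply: PresentTrans (_ : _ ~ fscale (- n%:Z) d ++ fscale (-1) d) _.
    by apply: PresentAdd => //; apply: fscale_opp_cong.
  by apply: PresentSym; apply: fscaleD.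
Qed.

End Presentations.

Section Sieves.
Variable K : fieldType.

Lemma fat_iso_refl (z : fatPoint K) : fat_iso z z.
Proof. by exists (mor_id z), (mor_id z); rewrite mor_comp_idl. Qed.

Lemma fat_iso_sym (z w : fatPoint K) : fat_iso z w -> fat_iso w z.
Proof. by move=> [f [g [fg gf]]]; exists g, f. Qed.

Lemma fat_iso_trans (z w u : fatPoint K) : fat_iso z w -> fat_iso w u -> fat_iso z u.
Proof.
move=> [f [f' [E1 E2]]] [g [g' [E3 E4]]]; exists (mor_comp g f), (mor_comp f' g').
split; rewrite mor_compA.
  by rewrite -(mor_compA f' g' g) E3 mor_comp_idr.
by rewrite -(mor_compA g f f') E2 mor_comp_idr.
Qed.

Lemma elt_eq (X : kscheme K) (S : sieve X) (z : fatPoint K) (a b : elt S z) :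
  sval a = sval b -> a = b.
Proof. by case: a b => [f Sf] [g Sg] /= E; subst g; rewrite (Prop_irrelevance Sf Sg). Qed.

Lemma fat_iso_full (z w : fatPoint K) : fat_iso z w ->
  sieve_iso (full_sieve z) (full_sieve w).
Proof.
move=> [f [g [E1 E2]]].
have push (u v : fatPoint K) (h : mor u v) : exists F : sieve_mor (full_sieve u) (full_sieve v),
    forall x (a : elt (full_sieve u) x), sval (F x a) = mor_comp h (sval a).
  unshelve eexists.
    refine (@SieveMor K u v (full_sieve u) (full_sieve v)
      (fun x a => exist _ (mor_comp h (sval a)) I) _).
    by move=> x y k a; apply: elt_eq => /=; rewrite mor_compA.
  by [].
have [F HF] := push _ _ f; have [G HG] := push _ _ g.
exists F, G => x; split=> a; apply: elt_eq; rewrite ?HF ?HG ?HF mor_compA ?E1 ?E2;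
  exact: mor_comp_idl.
Qed.

Definition monic_elt (X : kscheme K) (w : fatPoint K) (i : mor w X) : Prop :=
  forall (z : fatPoint K) (g h : mor z w), mor_comp i g = mor_comp i h -> g = h.

(** Factorizations through a monic [i] are unique, so choosing them is natural and inverts
    composition with [i]. *)
Lemma represented_sieve_iso (X : kscheme K) (S : sieve X) (w : fatPoint K) (i : mor w X) :
  monic_elt i -> (forall (z : fatPoint K) (f : mor z X), S z f <-> exists g, f = mor_comp i g) ->
  sieve_iso S (full_sieve w).
Proof.
move=> mi HS.
pose F (z : fatPoint K) (a : elt S z) : elt (full_sieve w) z :=
  exist _ (projT1 (cid ((HS z (sval a)).1 (svalP a)))) I.
have FK z a : sval a = mor_comp i (sval (@F z a)) by rewrite /F /=; case: cid.
have Fn (z u : fatPoint K) (g : mor u z) (a : elt S z) :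
    F u (elt_pull g a) = elt_pull g (F z a).
  by apply: elt_eq; apply: mi; rewrite -FK /= mor_compA -FK.
have Gp (z : fatPoint K) (a : elt (full_sieve w) z) : S z (mor_comp i (sval a)).
  by apply/HS; exists (sval a).
pose G (z : fatPoint K) (a : elt (full_sieve w) z) : elt S z := exist _ _ (Gp z a).
have Gn (z u : fatPoint K) (g : mor u z) (a : elt (full_sieve w) z) :
    G u (elt_pull g a) = elt_pull g (G z a).
  by apply: elt_eq; rewrite /= mor_compA.
exists (SieveMor Fn), (SieveMor Gn) => z; split=> a; apply: elt_eq => /=.
  exact: esym (FK z a).
by apply: mi; exact: esym (FK z (G z a)).
Qed.

Section Independence.
Variables (X : kscheme K) (I : finType) (n : I -> int) (w : I -> fatPoint K).
Variable a : forall i, mor (w i) X.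
Hypothesis mono_a : forall i, monic_elt (a i).

Let below (z : fatPoint K) (f : mor z X) (i : I) : bool :=
  `[< exists g, f = mor_comp (a i) g >].

Let below_trans (z : fatPoint K) (f : mor z X) i j :
  below f i -> below (a i) j -> below f j.
Proof.
move=> /asboolP[g ->] /asboolP[h ->]; apply/asboolP; exists (mor_comp h g).
by rewrite mor_compA.
Qed.

Let below_refl i : below (a i) i.
Proof. by apply/asboolP; exists (mor_id _); rewrite mor_comp_idr. Qed.

Let below_iso i j : below (a i) j -> below (a j) i -> fat_iso (w i) (w j).
Proof.
move=> /asboolP[g Eg] /asboolP[h Eh]; exists g, h; split; apply: mono_a.
  by rewrite mor_compA -Eh -Eg mor_comp_idr.
by rewrite mor_compA -Eg -Eh mor_comp_idr.
Qed.

(* Triangularity: evaluate at a maximal element, drop its class, and repeat. *)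
Lemma monic_independent (A : pred I) :
  (forall (z : fatPoint K) (f : mor z X), \sum_(i | A i && below f i) n i = 0) ->
  forall u, \sum_(i | A i && `[< fat_iso (w i) u >]) n i = 0.
Proof.
move: (leqnn #|A|); move: {2}#|A| => m; elim: m A => [|m IH] A Am H u.
  rewrite big1 // => i /andP[Ai _]; move: Am; rewrite leqn0 => /eqP/card0_eq/(_ i).
  by rewrite unfold_in /= Ai.
have [i0 Ai0|A0] := pickP A; last by rewrite big1 // => i /andP[]; rewrite A0.
(* Having the most elements factoring through it makes [a k] maximal for the factorization
   preorder. *)
pose cnt k := #|[pred j | A j && below (a j) k]|.
have [k Ak kmax] := @arg_maxnP _ i0 A cnt Ai0.
have maxk l : A l -> below (a k) l -> below (a l) k.
  move=> Al kl; apply/negPn/negP => nlk.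
  suff : (cnt k < cnt l)%N by rewrite ltnNge => /negP; apply; apply: kmax.
  apply: proper_card; apply/properP; split.
    apply/fintype.subsetP => j; rewrite !inE => /andP[-> jk] /=.
    exact: below_trans jk kl.
  by exists l; rewrite !inE Al ?below_refl.
pose eqv i := below (a i) k && below (a k) i.
(* At [a k] itself, the terms that count are, by maximality, exactly those equivalent to [k]. *)
have sum0 : \sum_(i | A i && eqv i) n i = 0.
  rewrite -[RHS](H _ (a k)); apply: eq_bigl => i; rewrite /eqv.
  by case Ai: (A i) => //=; case ki: (below (a k) i); rewrite ?andbF ?andbT //; apply: maxk.
(* A condition constant on the class of [k] contributes there all or nothing, hence [0]; used for
   isomorphism with [u] and for factoring [f]. *)
have split_sum (Q : pred I) : (forall i, eqv i -> Q i = Q k) ->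
    \sum_(i | A i && Q i) n i = \sum_(i | (A i && ~~ eqv i) && Q i) n i.
  move=> HQ; rewrite (bigID eqv) /= [X in X + _ = _](_ : _ = 0) ?add0r.
    by apply: eq_bigl => i; rewrite andbAC.
  have [Qk|Qk] := boolP (Q k).
    rewrite -[RHS]sum0; apply: eq_bigl => i.
    by case e: (eqv i); rewrite ?andbF // HQ // Qk !andbT.
  by rewrite big1 // => i /andP[/andP[_ Qi] /HQ]; rewrite Qi (negPf Qk).
rewrite split_sum; last first.
  move=> i /andP[ik ki]; have iso := below_iso ik ki.
  apply/asboolP/asboolP; last exact: fat_iso_trans.
  by apply: fat_iso_trans; apply: fat_iso_sym.
apply: (IH [pred i | A i && ~~ eqv i]).
  rewrite -ltnS; apply: leq_trans Am; apply: proper_card; apply/properP; split.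
    by apply/fintype.subsetP => i; rewrite !inE => /andP[].
  by exists k; rewrite ?inE /eqv ?below_refl //= andbF.
move=> z f; rewrite -[RHS](H z f) split_sum // => i /andP[ik ki].
by apply/idP/idP => fi; [apply: below_trans ik|apply: below_trans ki].
Qed.

End Independence.
End Sieves.

(** * Decompositions of motives *)

Fixpoint allp (T : Type) (P : T -> Prop) (l : seq T) : Prop :=
  if l is x :: l' then P x /\ allp P l' else True.

Lemma allp_cat T (P : T -> Prop) l1 l2 : allp P (l1 ++ l2) <-> allp P l1 /\ allp P l2.
Proof. by elim: l1 => [|x l IH] /=; [split=> [|[]]|rewrite IH; tauto]. Qed.

Lemma allp_map T U (P : U -> Prop) (f : T -> U) l : allp P (map f l) <-> allp (P \o f) l.
Proof. by elim: l => //= x l ->. Qed.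

Lemma allp_impl T (P Q : T -> Prop) l : (forall x, P x -> Q x) -> allp P l -> allp Q l.
Proof. by move=> PQ; elim: l => //= x l IH [/PQ ? /IH]. Qed.

Lemma allp_nth T (P : T -> Prop) x0 l i : (i < size l)%N -> allp P l -> P (nth x0 l i).
Proof. by elim: l i => //= x l IH [|i] il [Px Pl] //=; apply: IH. Qed.

Section Decompositions.
Variable K : fieldType.

Definition monic_combination (X : kscheme K) := seq (int * {w : fatPoint K & mor w X}).

Definition factors (X : kscheme K) (z : fatPoint K) (f : mor z X)
    (d : int * {w : fatPoint K & mor w X}) : bool :=
  `[< exists g, f = mor_comp (projT2 d.2) g >].

(* The indicator function of [S] is the given combination of indicator
   functions of sieves represented by monic elements of [S]. *)
Definition decomposes (X : kscheme K) (S : sieve X) (D : monic_combination X) : Prop :=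
  allp (fun d => monic_elt (projT2 d.2) /\ S _ (projT2 d.2)) D /\
  forall z f, (`[< S z f >] : nat)%:Z = \sum_(d <- D | factors f d) d.1.

Definition fat_coef (X : kscheme K) (u : fatPoint K) (D : monic_combination X) : int :=
  \sum_(d <- D | `[< fat_iso (projT1 d.2) u >]) d.1.

Definition dopp (X : kscheme K) (D : monic_combination X) : monic_combination X :=
  [seq (- d.1, d.2) | d <- D].

Lemma sum_factors_dopp (X : kscheme K) (D : monic_combination X) (z : fatPoint K) (f : mor z X) :
  \sum_(d <- dopp D | factors f d) d.1 = - \sum_(d <- D | factors f d) d.1.
Proof. by rewrite big_map -sumrN. Qed.

Lemma fat_coef_cat (X : kscheme K) u (D E : monic_combination X) :
  fat_coef u (D ++ E) = fat_coef u D + fat_coef u E.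
Proof. by rewrite /fat_coef big_cat. Qed.

Lemma fat_coef_dopp (X : kscheme K) u (D : monic_combination X) :
  fat_coef u (dopp D) = - fat_coef u D.
Proof. by rewrite /fat_coef big_map -sumrN. Qed.

Lemma fat_coef_eq0 (X : kscheme K) (D : monic_combination X) u :
  allp (fun d => monic_elt (projT2 d.2)) D ->
  (forall (z : fatPoint K) (f : mor z X), \sum_(d <- D | factors f d) d.1 = 0) ->
  fat_coef u D = 0.
Proof.
case: D => [|d0 D']; first by rewrite /fat_coef big_nil.
set D := d0 :: D' => mD H; pose t (i : 'I_(size D)) := nth d0 D i.
have sumE (P : pred _) : \sum_(d <- D | P d) d.1 = \sum_(i < size D | P (t i)) (t i).1.
  by rewrite (big_nth d0) big_mkord.
rewrite /fat_coef sumE.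
apply: (@monic_independent K X _ (fun i => (t i).1) (fun i => projT1 (t i).2)
  (fun i => projT2 (t i).2) _ predT).
  by move=> i; exact: (allp_nth d0 (ltn_ord i) mD).
by move=> z f; rewrite -[RHS](H z f) [RHS]sumE.
Qed.

Lemma decomposes_monic (X : kscheme K) (S : sieve X) D : decomposes S D ->
  allp (fun d => monic_elt (projT2 d.2)) D.
Proof. by case=> + _; apply: allp_impl => d []. Qed.

Lemma dopp_monic (X : kscheme K) (D : monic_combination X) :
  allp (fun d => monic_elt (projT2 d.2)) D ->
  allp (fun d => monic_elt (projT2 d.2)) (dopp D).
Proof. by move=> mD; apply/allp_map. Qed.

(** The difference of two decompositions has zero indicator function, and monic elements are
    independent. *)
Lemma fat_coef_uniq (X : kscheme K) (S : sieve X) D E u :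
  decomposes S D -> decomposes S E -> fat_coef u D = fat_coef u E.
Proof.
move=> dD dE; apply/eqP; rewrite -subr_eq0 -fat_coef_dopp -fat_coef_cat; apply/eqP.
apply: fat_coef_eq0.
  by apply/allp_cat; split; [|apply: dopp_monic]; apply: decomposes_monic; eassumption.
by move=> z f; rewrite big_cat /= sum_factors_dopp -dD.2 -dE.2 subrr.
Qed.

(** Inclusion-exclusion for indicator functions. *)
Lemma decomposes_scissor (X : kscheme K) (S T : sieve X) DS DT DI :
  decomposes S DS -> decomposes T DT -> decomposes (sieve_inter S T) DI ->
  decomposes (sieve_union S T) (DS ++ DT ++ dopp DI).
Proof.
move=> [aS eS] [aT eT] [aI eI]; split.
  apply/allp_cat; split; [|apply/allp_cat; split; [|apply/allp_map]].
  - by apply: allp_impl aS => d [md Sd]; split=> //; left.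
  - by apply: allp_impl aT => d [md Sd]; split=> //; right.
  - by apply: allp_impl aI => d [md [Sd Td]]; split=> //; left.
move=> z f; rewrite !big_cat /= sum_factors_dopp -eS -eT -eI.
rewrite asbool_or asbool_and.
by case: asboolP => _; case: asboolP => _.
Qed.

(** Elements are transported along the inverse isomorphism; by naturality, factoring through an
    element and being monic are preserved. *)
Lemma decomposes_iso (X Y : kscheme K) (S : sieve X) (T : sieve Y) D :
  sieve_iso S T -> decomposes T D ->
  exists2 E, decomposes S E & forall u, fat_coef u E = fat_coef u D.
Proof.
move=> [F [G FG]] [aT eT].
have lift (w : fatPoint K) (a : mor w Y) : T w a -> exists b : mor w X, S w b /\
    (monic_elt a -> monic_elt b) /\
    forall z (f : elt S z), (exists g, sval f = mor_comp b g) <->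
      exists g, sval (F z f) = mor_comp a g.
  move=> Ta; pose ta : elt T w := exist _ a Ta; pose sb := G w ta.
  have Fb : F w sb = ta by rewrite /sb (FG w).2.
  have Fpull (z : fatPoint K) (g : mor z w) : sval (F z (elt_pull g sb)) = mor_comp a g.
    by rewrite sm_natural Fb.
  exists (sval sb); split; first exact: svalP.
  split=> [ma z g h E|z f].
    apply: ma; rewrite -!Fpull; congr (sval (F z _)); exact: elt_eq.
  split=> -[g E]; exists g.
    by rewrite -Fpull; congr (sval (F z _)); exact: elt_eq.
  have : F z f = F z (elt_pull g sb) by apply: elt_eq; rewrite Fpull.
  by move/(can_inj (FG z).1) => ->.
have [E [aE [eE cE]]] : exists E : monic_combination X,
    allp (fun d => monic_elt (projT2 d.2) /\ S _ (projT2 d.2)) E /\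
    (forall z (f : elt S z), \sum_(d <- E | factors (sval f) d) d.1 =
       \sum_(d <- D | factors (sval (F z f)) d) d.1) /\
    forall u, fat_coef u E = fat_coef u D.
  elim: D aT {eT} => [|[k [w a]] D IH] /=.
    move=> _; exists [::]; split=> //; split=> [z f|u]; first by rewrite !big_nil.
    by rewrite /fat_coef !big_nil.
  move=> [[ma Ta] /IH[E [aE [eE cE]]]]; have [b [Sb [mb Hb]]] := lift _ _ Ta.
  exists ((k, existT _ w b) :: E); split; first by split=> //; split=> //; apply: mb.
  split=> [z f|u]; last by have := cE u; rewrite /fat_coef !big_cons /= => ->.
  rewrite !big_cons eE.
  have -> : factors (sval f) (k, existT _ w b) = factors (sval (F z f)) (k, existT _ w a).
    by apply/asboolP/asboolP => /Hb.
  by [].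
exists E => //; split=> // z f.
have [Sf|nSf] := pselect (S z f).
  pose sf : elt S z := exist _ f Sf.
  have -> : `[< S z f >] = `[< T z (sval (F z sf)) >].
    by rewrite (asboolT Sf) (asboolT (svalP (F z sf))).
  by rewrite eT -eE.
(* Outside [S] every term vanishes: whatever factors through an element of [S] is in [S]. *)
rewrite (asboolF nSf); elim: E aE {eE cE} => [|d E IH] /=; first by rewrite big_nil.
move=> [[_ Sd] /IH]; rewrite big_cons ifF //.
by apply/asboolP => -[g Ef]; apply: nSf; rewrite Ef; apply: sv_comp.
Qed.

(** Independent of the decomposition by [fat_coef_uniq]; the default [0] concerns only sieves
    without one. *)
Definition class_coef (u : fatPoint K) (X : kscheme K) (S : sieve X) : int :=
  xget 0 [set m | exists2 D, decomposes S D & m = fat_coef u D].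

Lemma class_coefE u (X : kscheme K) (S : sieve X) D :
  decomposes S D -> class_coef u S = fat_coef u D.
Proof.
move=> dD; rewrite /class_coef; case: xgetP => [m _ [E dE ->]|/(_ (fat_coef u D))[]].
  exact: fat_coef_uniq dE dD.
by exists D.
Qed.

Lemma class_coef_fat u (z : fatPoint K) :
  class_coef u (full_sieve z) = (`[< fat_iso z u >] : nat)%:Z.
Proof.
rewrite (@class_coefE _ _ _ [:: (1, existT _ z (mor_id z))]).
  by rewrite /fat_coef big_cons big_nil /=; case: asboolP.
split=> [|w f] /=.
  by split=> //; split=> // w g h; rewrite !mor_comp_idl.
rewrite (asboolT I) big_cons big_nil ifT //.
by apply/asboolP; exists f; rewrite mor_comp_idl.
Qed.

End Decompositions.

(** * Classes of motives as combinations of fat points *)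

Section Spanning.
Variable K : closedFieldType.

Definition fat_class (X : kscheme K) (D : monic_combination X) : formal_sum (motif0 K) :=
  [seq (d.1, fat_motif (projT1 d.2)) | d <- D].

(** One combination serves both the indicator function and the class. The induction is on the length
    of [L]: splitting off [p] leaves the intersection with the tail, described by
    [map (meet_family p) L], which is no sublist but is as short as the tail. *)
Lemma killed_decomposes (X : kscheme K) (dX : zero_dim X) (L : seq (X * section_family X)) :
  exists2 D, decomposes (killed_sieve L) D &
    forall hS : schemic (killed_sieve L), gr0_eq [:: (1, Motif0 dX hS)] (fat_class D).
Proof.
move: (leqnn (size L)); move: {2}(size L) => n; elim: n L => [|n IH] [|p L] // sL.
1,2: exists [::] => [|hS]; [by split=> // z f; rewrite big_nil asboolF|];
  by apply: PresentRel; apply: Gr0Empty => z f.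
have [DT dT gT] : exists2 D, decomposes (killed_sieve [:: p]) D &
    forall hS : schemic (killed_sieve [:: p]), gr0_eq [:: (1, Motif0 dX hS)] (fat_class D).
  have [none|[w [i [_ mi H]]]] := kills_represented dX p.1 p.2.
    have T0 (z : fatPoint K) (f : mor z X) : ~ killed_sieve [:: p] z f by move=> /= [/none|].
    exists [::] => [|hS]; first by split=> // z f; rewrite big_nil asboolF.
    by apply: PresentRel; apply: Gr0Empty => z f; apply: T0.
  have H' (z : fatPoint K) (f : mor z X) : killed_sieve [:: p] z f <-> exists g, f = mor_comp i g.
    by rewrite -H /=; tauto.
  exists [:: (1, existT _ w i)] => [|hS].
    split=> /= [|z f]; last first.
      rewrite big_cons big_nil /factors /=.
      have -> : `[< kills f p.1 p.2 \/ False >] = `[< exists g, f = mor_comp i g >].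
        by apply/asboolP/asboolP => /H'.
      by case: asboolP.
    by split=> //; split=> //; apply/H'; exists (mor_id w); rewrite mor_comp_idr.
  have R : gr0_eq [:: (1, Motif0 dX hS); (-1, fat_motif w)] [::].
    by apply: PresentRel; apply: Gr0Iso; apply: represented_sieve_iso mi H'.
  by apply: present_sub; rewrite /= mulr1.
have [|DL dL gL] := IH L; first by [].
have [|DI dI gI] := IH (map (meet_family p) L); first by rewrite size_map.
have EU : killed_sieve (p :: L) = sieve_union (killed_sieve [:: p]) (killed_sieve L).
  by apply: sieve_ext => z f /=; split=> [[|]|[[|//]|]]; tauto.
have EI : killed_sieve (map (meet_family p) L) = sieve_inter (killed_sieve [:: p]) (killed_sieve L).
  by apply: sieve_ext => z f /=; rewrite killed_meet; tauto.
rewrite EI in dI gI; rewrite EU.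
exists (DT ++ DL ++ dopp DI); first exact: decomposes_scissor.
move=> hU; have hT := schemic_killed_sieve dX [:: p]; have hL := schemic_killed_sieve dX L.
have hI : schemic (sieve_inter (killed_sieve [:: p]) (killed_sieve L)).
  by rewrite -EI; apply: schemic_killed_sieve.
have := PresentRel (Gr0Scissor dX hT hL hU hI).
set T := Motif0 dX hT; set M := Motif0 dX hL; set U := Motif0 dX hU; set N := Motif0 dX hI.
move=> R.
have R1 : gr0_eq [:: (1, U); (1, N)] [:: (1, T); (1, M)].
  apply: PresentSym.
  by apply: present_sub; rewrite /= mulr1.
have R2 : gr0_eq [:: (1, U)] ([:: (1, T); (1, M)] ++ fscale (-1) [:: (1, N)]).
  apply: PresentTrans (present_catl _ R1).
  rewrite -[X in present_eq _ X _]cats0.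
  rewrite -[X in present_eq _ _ X]/([:: (1, U)] ++ ([:: (1, N)] ++ fscale (-1) [:: (1, N)])).
  by apply: present_catr; apply: PresentSym; apply: fscaleNr.
apply: PresentTrans R2 _.
rewrite /fat_class !map_cat catA; apply: PresentAdd.
  exact: (PresentAdd (gT hT) (gL hL)).
have -> : [seq (d.1, fat_motif (projT1 d.2)) | d <- dopp DI] = fscale (-1) (fat_class DI).
  by rewrite /dopp /fscale /fat_class -!map_comp; apply: eq_map => d; rewrite /= mulN1r.
by apply: fscale_cong; apply: gI.
Qed.

Lemma motif_decomposes (M : motif0 K) : exists2 D, decomposes (mo_sieve M) D &
  gr0_eq [:: (1, M)] (fat_class D).
Proof.
case: M => X dX S hS; have [L HL] := schemic_killed_by dX hS.
have ES : S = killed_sieve L by apply: sieve_ext.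
by subst S; have [D dD gD] := killed_decomposes dX L; exists D.
Qed.

Definition coef_sum (u : fatPoint K) (c : formal_sum (motif0 K)) : int :=
  \sum_(p <- c) p.1 * class_coef u (mo_sieve p.2).

(** Relators have coefficient sum [0]: scissor relations by inclusion-exclusion, isomorphisms by
    transport of decompositions, the empty motif by the empty decomposition. *)
Lemma gr0_eq_coef_sum u c d : gr0_eq c d -> coef_sum u c = coef_sum u d.
Proof.
rewrite /coef_sum; elim=> {c d} [c //|c d _ -> //|c d e _ -> _ -> //|c c' d d' _ E1 _ E2|c d|x|m n x|r].
- by rewrite !big_cat /= E1 E2.
- by rewrite !big_cat /= addrC.
- by rewrite big_cons !big_nil mul0r addr0.
- by rewrite !big_cons !big_nil !addr0 mulrDl.
case=> [X dX S T hS hT hU hI|A B iso|A A0].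
- have [DS dS _] := motif_decomposes (Motif0 dX hS).
  have [DT dT _] := motif_decomposes (Motif0 dX hT).
  have [DI dI _] := motif_decomposes (Motif0 dX hI).
  rewrite !big_cons !big_nil /= (class_coefE u dS) (class_coefE u dT) (class_coefE u dI).
  rewrite (class_coefE u (decomposes_scissor dS dT dI)) !fat_coef_cat fat_coef_dopp.
  by rewrite !mul1r !mulN1r addr0 -opprD -(addrA (fat_coef u DS)) subrK addrA subrr.
- have [DB dB _] := motif_decomposes B.
  have [DA dA E] := decomposes_iso iso dB.
  rewrite !big_cons !big_nil /= (class_coefE u dA) (class_coefE u dB) E.
  by rewrite mul1r mulN1r addr0 subrr.
- rewrite big_cons !big_nil addr0 mul1r /=.
  rewrite (@class_coefE _ _ _ _ [::]) ?/fat_coef ?big_nil //.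
  by split=> // z f; rewrite big_nil asboolF.
Qed.

Lemma gr0_spanned (c : formal_sum (motif0 K)) : exists E : seq (int * fatPoint K),
  gr0_eq c [seq (e.1, fat_motif e.2) | e <- E].
Proof.
elim: c => [|[m M] c [E HE]]; first by exists [::]; apply: PresentRefl.
have [D _ gD] := motif_decomposes M.
exists ([seq (m * d.1, projT1 d.2) | d <- D] ++ E); rewrite map_cat.
apply: (@PresentAdd _ _ [:: _]) HE.
have := fscale_cong m gD; rewrite /fscale /= mulr1 /fat_class -!map_comp.
by apply.
Qed.

End Spanning.

(* The isomorphism classes of fat points form a basis of the abelian group
   Gr_0(Sch_K), whose equality is [gr0_eq]: the class of a fat point depends
   only on its isomorphism class, these classes span, and those of pairwise
   non-isomorphic fat points are linearly independent over the integers. *)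
Theorem proposition14p4 (K : closedFieldType) :
  (forall z w : fatPoint K, fat_iso z w ->
     gr0_eq [:: (1, fat_motif z)] [:: (1, fat_motif w)]) /\
  (forall c : formal_sum (motif0 K),
     exists (n : nat) (a : 'I_n -> int) (z : 'I_n -> fatPoint K),
       gr0_eq c (fat_sum a z)) /\
  (forall (n : nat) (a : 'I_n -> int) (z : 'I_n -> fatPoint K),
     (forall i j : 'I_n, i <> j -> ~ fat_iso (z i) (z j)) ->
     gr0_eq (fat_sum a z) [::] -> forall i : 'I_n, a i = 0).
Proof.
split; [|split].
- move=> z w iso; apply: present_sub; rewrite /= mulr1.
  by apply: PresentRel; apply: Gr0Iso; apply: fat_iso_full.
- move=> c; have [E HE] := gr0_spanned c.
  case: E HE => [|e0 E'] HE.
    exists 0%N, (fun=> 0), (fun i : 'I_0 => match notF (ltn_ord i) with end).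
    by rewrite /fat_sum (size0nil (s := enum 'I_0)) // size_enum_ord.
  set E := e0 :: E' in HE *.
  exists (size E), (fun i => (nth e0 E i).1), (fun i => (nth e0 E i).2).
  suff <- : [seq (e.1, fat_motif e.2) | e <- E] = fat_sum (fun i : 'I_(size E) => (nth e0 E i).1)
    (fun i => (nth e0 E i).2) by [].
  rewrite /fat_sum -{1}(mkseq_nth e0 E) /mkseq -val_enum_ord -!map_comp.
  exact: eq_map.
- move=> n a z niso H i.
  (* The coefficient at [z i] retains only [a i], the other fat points not being isomorphic to
     [z i]. *)
  have := gr0_eq_coef_sum (z i) H; rewrite /coef_sum big_nil big_map /= big_enum /=.
  rewrite (bigD1 i) //= class_coef_fat asboolT; last exact: fat_iso_refl.
  rewrite mulr1 big1 ?addr0 // => j ji.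
  by rewrite class_coef_fat asboolF ?mulr0 //; apply: niso; apply/eqP.
Qed.
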